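(* Let $G$ be a finite connected multigraph of genus $g$ and let $\Upsilon$ be the $(1,2)$-chain on $\mathrm{Jac}(G)$ constructed (as in the context) from a basepoint $v$, edge orientations, and a spanning tree $T$ with labelled complementary edges $e_1,\dots,e_g$. Let $S\subset E(G)\times E(G)$ contain exactly one element of $\{(e,e'),(e',e)\}$ for each pair of distinct edges $e,e'$ (and no other elements), and let $S'\subset\{1,\dots,g\}^3$ contain exactly one permutation of each tuple $(i,j,k)$ of pairwise distinct indices (and no other elements). Then one may write $$\Theta(\Upsilon)=\sum_{\substack{(e,e')\in S\\(i,j,k)\in S'}}a_{i,j,k}(e,e')\,x_ex_{e'}\,\epsilon_i\wedge\epsilon_j\wedge\epsilon_k,$$ where $a_{i,j,k}(e,e')$ takes values in $\{0,\pm2\}$ and is nonzero precisely when, up to relabeling $(i,j,k)$, $\gamma_i$ contains both $e$ and $e'$, $\gamma_j$ contains $e$ but not $e'$, and $\gamma_k$ contains $e'$ but not $e$. In particular, in that case (with $(i,j,k)$ so labelled; permuting $(i,j,k)$ changes $a_{i,j,k}(e,e')$ by the sign of the permutation), $$a_{i,j,k}(e,e')=2f_j(e)f_k(e')\big(f_i(e)f_i(e')h_i(e,e')+2f_i(e)g_j(e')-2f_i(e')g_k(e)\big),$$ and reversing the cyclic orientation of any one of the cycles $\gamma_i,\gamma_j,\gamma_k$ flips the sign of $a_{i,j,k}(e,e')$.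
   Context: **Universal objects.** $G$ has vertex set $V(G)$, edge set $E(G)$, genus $g=\#E(G)-\#V(G)+1$. $C_1(G,\mathbb{Z})$ is the group of oriented simplicial 1-chains, $H_1(G,\mathbb{Z})\subset C_1(G,\mathbb{Z})$ the cycles; paths are viewed as 1-chains. $R=\mathbb{Z}[x_e:e\in E(G)]$, $N=H^1(G,\mathbb{Z})$, $N_R=R\otimes N\cong\mathrm{Hom}(H_1(G,\mathbb{Z}),R)$, $N_R^{\wedge3}$ is taken over $R$. $[\cdot,\cdot]$ is the bilinear pairing on $C_1(G,\mathbb{Z})$ with $[e,e]=x_e$, $[e,e']=0$ for $e\ne e'$; $\pi(c)=[c,\cdot]\in N_R$; $\Lambda=\pi(H_1(G,\mathbb{Z}))$. $C_q(\mathrm{Jac}(G))$ is the free abelian group on tuples $(u_0,\dots,u_q)\in N_R^{q+1}$ modulo simultaneous translation by elements of $\Lambda$; $C_{1,2}(\mathrm{Jac}(G))=N\otimes_{\mathbb{Z}}C_2(\mathrm{Jac}(G))$ is the group of $(1,2)$-chains. $\Theta:C_{1,2}(\mathrm{Jac}(G))\to N_R^{\wedge3}$, $\Theta(n\otimes(u_0,u_1,u_2))=n\wedge(u_1-u_0)\wedge(u_2-u_0)$. **The chain $\Upsilon$.** Fix a basepoint $v\in V(G)$, edge orientations, and a spanning tree $T$; label the edges not in $T$ by $e_1,\dots,e_g$. Let $\gamma_i$ be the simple cycle using only edges of $E(T)\cup\{e_i\}$, with positive $e_i$-coefficient (this fixes its cyclic orientation; reversing the cyclic orientation means replacing $\gamma_i$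 by $-\gamma_i$, i.e. reversing the orientation of $e_i$). Then $\gamma_1,\dots,\gamma_g$ is a basis of $H_1(G,\mathbb{Z})$; let $\epsilon_1,\dots,\epsilon_g$ be the dual basis of $N$. Let $\delta_i$ be the unique path in $T$ from $v$ to a vertex $p_{i,0}$ of $\gamma_i$ sharing no edges with $\gamma_i$. Following the cyclic orientation of $\gamma_i$, label its successive vertices $p_{i,0},p_{i,1},\dots,p_{i,n_i}=p_{i,0}$, and let $e_{i,j}$ be the edge of $\gamma_i$ between $p_{i,j}$ and $p_{i,j+1}$. With $f_i(e)=x_e^{-1}[e,\gamma_i]\in\{0,\pm1\}$, put $u_{i,j}=\pi\big(\delta_i+\sum_{k=0}^{j-1}f_i(e_{i,k})e_{i,k}\big)$ for $0\le j\le n_i$. Then $\Upsilon=\sum_{i=1}^g\epsilon_i\otimes\Upsilon_i$ with $$\begin{aligned}\Upsilon_i=&\sum_{j=1}^{n_i-1}\big((u_{i,0},u_{i,j},u_{i,j+1})+(-u_{i,0},-u_{i,j},-u_{i,j+1})\big)+(u_{i,0},u_{i,n_i},-u_{i,0})+(u_{i,0},-u_{i,0},-u_{i,n_i})\\&-\sum_{j:\,f_i(e_{i,j})=-1}\big((u_{i,j},u_{i,j+1},u_{i,j})+(u_{i,j},u_{i,j},u_{i,j})+(-u_{i,j},-u_{i,j+1},-u_{i,j})+(-u_{i,j},-u_{i,j},-u_{i,j})\big).\end{aligned}$$ **Indicator functions.** $f_i(e)$ is $0$ if $e\notin\mathrm{supp}\,\gamma_i$, and $1$ (resp. $-1$)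 if $e$ and $\gamma_i$ have the same (resp. opposite) orientation. $g_i(e)=x_e^{-1}[e,\delta_i]$ is $0$ if $e\notin\mathrm{supp}\,\delta_i$, and $1$ (resp. $-1$) if $e$ and $\delta_i$ have the same (resp. opposite) orientation. For distinct edges $e,e'$ of $\gamma_i$, write $e<_ie'$ if $e$ occurs before $e'$ in the ordering $e_{i,0},e_{i,1},\dots,e_{i,n_i-1}$. Then $h_i(e,e')=0$ if $e\notin\mathrm{supp}\,\gamma_i$, $e'\notin\mathrm{supp}\,\gamma_i$ or $e=e'$; $h_i(e,e')=1$ if $e<_ie'$; $h_i(e,e')=-1$ if $e'<_ie$. *)

(* Defs.v *)
From HB Require Import structures.
From mathcomp Require Import all_boot all_order all_algebra all_fingroup.
From mathcomp Require Import generic_quotient ring_quotient.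
From mathcomp Require Import boolp functions.
From mathcomp Require Import freeg mpoly.

Set Implicit Arguments.
Unset Strict Implicit.
Unset Printing Implicit Defensive.

Import GRing.Theory.
Local Open Scope ring_scope.
Local Open Scope quotient_scope.

(* [span rel] is the submodule generated by [rel]. Membership is not decidable,
   so the quotient uses its classical boolean reflection [spanb]. *)
Inductive span (R : pzRingType) (L : lmodType R) (rel : L -> Prop) : L -> Prop :=
| span_rel x : rel x -> span rel x
| span0 : span rel 0
| span_lin a x y : span rel x -> span rel y -> span rel (a *: x + y).

Section QuotientModule.
Variables (R : pzRingType) (L : lmodType R) (rel : L -> Prop).

Definition spanb : L -> bool := fun x => `[< span rel x >].

Lemma spanb_submod_closed : submod_closed spanb.
Proof.
split=> [|a x y /asboolP sx /asboolP sy]; apply/asboolP; first exact: span0.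
exact: span_lin.
Qed.

HB.instance Definition _ := GRing.isZmodClosed.Build L spanb
  (GRing.submod_closedB spanb_submod_closed).

Definition span_pred : zmodClosed L := GRing.ZmodClosed.clone L spanb _.

Definition quotm := Quotient.quot span_pred.

HB.instance Definition _ := GRing.Zmodule.on quotm.

Definition qproj (x : L) : quotm := \pi_(Quotient.quot span_pred) x.

Definition qscale (a : R) (x : quotm) : quotm :=
  qproj (a *: repr (x : Quotient.quot span_pred)).

Lemma qproj_eq x y : qproj x = qproj y <-> span rel (x - y).
Proof.
have := Quotient.idealrBE span_pred x y.
rewrite unfold_in /= => e; split=> [h|h].
  by apply/asboolP; rewrite e; apply/eqP.
by apply/eqP; rewrite -e; apply/asboolP.
Qed.

Lemma qprojB : {morph qproj : x y / x - y}.
Proof. by move=> x y; rewrite /qproj !piE. Qed.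

Lemma qprojD : {morph qproj : x y / x + y}.
Proof. by move=> x y; rewrite /qproj !piE. Qed.

Lemma qprojK (x : quotm) : exists y, qproj y = x.
Proof. by exists (repr (x : Quotient.quot span_pred)); apply: reprK. Qed.

Lemma qscaleE a x : qscale a (qproj x) = qproj (a *: x).
Proof.
apply/qproj_eq; rewrite -scalerBr -[_ *: _]addr0; apply: span_lin (span0 _).
by apply/qproj_eq; apply: reprK.
Qed.

Lemma qscaleA a b x : qscale a (qscale b x) = qscale (a * b) x.
Proof. by case: (qprojK x) => y <-; rewrite !qscaleE scalerA. Qed.

Lemma qscale1 : left_id 1 qscale.
Proof. by move=> x; case: (qprojK x) => y <-; rewrite qscaleE scale1r. Qed.

Lemma qscaleDr : right_distributive qscale +%R.
Proof.
move=> a x y; case: (qprojK x) => x' <-; case: (qprojK y) => y' <-.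
by rewrite -qprojD !qscaleE scalerDr qprojD.
Qed.

Lemma qscaleDl x : {morph qscale^~ x : a b / a + b}.
Proof.
by move=> a b; case: (qprojK x) => x' <-; rewrite !qscaleE scalerDl qprojD.
Qed.

HB.instance Definition _ := GRing.Zmodule_isLmodule.Build R quotm
  qscaleA qscale1 qscaleDr qscaleDl.

Lemma qprojZ a x : qproj (a *: x) = a *: qproj x.
Proof. by rewrite -qscaleE. Qed.

Lemma qproj_rel x : rel x -> qproj x = 0.
Proof.
move=> rx; rewrite -(subrr (qproj 0)) -qprojB subr0.
by apply/qproj_eq; rewrite subr0; apply: span_rel.
Qed.

End QuotientModule.

Section Exterior.
Variables (R : comNzRingType) (M : lmodType R).

Inductive ext3_rel : {freeg (M * M * M) / R} -> Prop :=
| ext3_lin1 a u u' v w :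
    ext3_rel (<< (a *: u + u', v, w) >> - (a *: << (u, v, w) >> + << (u', v, w) >>))
| ext3_lin2 a u v v' w :
    ext3_rel (<< (u, a *: v + v', w) >> - (a *: << (u, v, w) >> + << (u, v', w) >>))
| ext3_lin3 a u v w w' :
    ext3_rel (<< (u, v, a *: w + w') >> - (a *: << (u, v, w) >> + << (u, v, w') >>))
| ext3_alt12 u v : ext3_rel << (u, u, v) >>
| ext3_alt23 u v : ext3_rel << (u, v, v) >>
| ext3_alt13 u v : ext3_rel << (u, v, u) >>.

Definition ext3 := quotm ext3_rel.
HB.instance Definition _ := GRing.Lmodule.on ext3.

Definition wedge3 (u v w : M) : ext3 := qproj ext3_rel << (u, v, w) >>.

Lemma wedge3_lin1 a u u' v w :
  wedge3 (a *: u + u') v w = a *: wedge3 u v w + wedge3 u' v w.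
Proof.
rewrite /wedge3 -qprojZ -qprojD; apply/qproj_eq; apply: span_rel.
exact: ext3_lin1.
Qed.

Lemma wedge3_lin2 a u v v' w :
  wedge3 u (a *: v + v') w = a *: wedge3 u v w + wedge3 u v' w.
Proof.
rewrite /wedge3 -qprojZ -qprojD; apply/qproj_eq; apply: span_rel.
exact: ext3_lin2.
Qed.

Lemma wedge3_lin3 a u v w w' :
  wedge3 u v (a *: w + w') = a *: wedge3 u v w + wedge3 u v w'.
Proof.
rewrite /wedge3 -qprojZ -qprojD; apply/qproj_eq; apply: span_rel.
exact: ext3_lin3.
Qed.

Lemma wedge3_alt12 u v : wedge3 u u v = 0.
Proof. exact/qproj_rel/ext3_alt12. Qed.

Lemma wedge3_alt23 u v : wedge3 u v v = 0.
Proof. exact/qproj_rel/ext3_alt23. Qed.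

Lemma wedge3_alt13 u v : wedge3 u v u = 0.
Proof. exact/qproj_rel/ext3_alt13. Qed.

End Exterior.

Section Tensor.
Variables (A B : zmodType).

Inductive tensor_rel : {freeg (A * B) / int} -> Prop :=
| tensor_addl a a' b :
    tensor_rel (<< (a + a', b) >> - (<< (a, b) >> + << (a', b) >>))
| tensor_addr a b b' :
    tensor_rel (<< (a, b + b') >> - (<< (a, b) >> + << (a, b') >>)).

Definition tensor := quotm tensor_rel.
HB.instance Definition _ := GRing.Lmodule.on tensor.

Definition tens (a : A) (b : B) : tensor := qproj tensor_rel << (a, b) >>.

Lemma tensDl a a' b : tens (a + a') b = tens a b + tens a' b.
Proof.
by rewrite /tens -qprojD; apply/qproj_eq; apply: span_rel; apply: tensor_addl.
Qed.

Lemma tensDr a b b' : tens a (b + b') = tens a b + tens a b'.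
Proof.
by rewrite /tens -qprojD; apply/qproj_eq; apply: span_rel; apply: tensor_addr.
Qed.

End Tensor.

Section Chains.
Variables (A : zmodType) (Lam : A -> Prop) (q : nat).

Inductive translate_rel : {freeg (q.+1.-tuple A) / int} -> Prop :=
| translate l (u : q.+1.-tuple A) : Lam l ->
    translate_rel (<< [tuple tnth u i + l | i < q.+1] >> - << u >>).

Definition chains := quotm translate_rel.
HB.instance Definition _ := GRing.Lmodule.on chains.

Definition simplex (u : q.+1.-tuple A) : chains := qproj translate_rel << u >>.

End Chains.

Section Lift.
Variables (K : choiceType) (rel : {freeg K / int} -> Prop) (W : zmodType).

(* [fglift] wants an [int]-module as its target; [zmodule W] is [W] seen as one. *)
Definition zlift (f : K -> W) : {freeg K / int} -> W :=
  fglift (f : K -> zmodule W).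

Definition qlift (f : K -> W) : quotm rel -> W :=
  fun x => zlift f (repr (x : Quotient.quot (span_pred rel))).

Lemma zliftB f : {morph zlift f : x y / x - y}.
Proof. exact: (lift_is_additive (f : K -> zmodule W)). Qed.

Lemma zlift0 f : zlift f 0 = 0.
Proof. by have := zliftB f 0 0; rewrite subr0 subrr. Qed.

Lemma zliftN f : {morph zlift f : x / - x}.
Proof. by move=> x; rewrite -[- x]sub0r zliftB zlift0 sub0r. Qed.

Lemma zliftD f : {morph zlift f : x y / x + y}.
Proof. by move=> x y; rewrite -[y in LHS]opprK zliftB zliftN opprK. Qed.

Lemma zliftU f k : zlift f << k >> = f k.
Proof. by rewrite /zlift liftU scale1r. Qed.

HB.instance Definition _ f :=
  GRing.isZmodMorphism.Build {freeg K / int} W (zlift f) (zliftB f).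

Variable f : K -> W.
Hypothesis f_rel : forall x, rel x -> zlift f x = 0.

Lemma qliftE x : qlift f (qproj rel x) = zlift f x.
Proof.
apply/eqP; rewrite -subr_eq0 /qlift -zliftB; apply/eqP.
have: span rel (repr (qproj rel x : Quotient.quot (span_pred rel)) - x).
  by apply/qproj_eq; apply: reprK.
elim=> [y /f_rel//||a y z _ IHy _ IHz]; first exact: zlift0.
have zliftM : zlift f (y *~ a) = zlift f y *~ a by apply: raddfMz.
by rewrite zliftD IHz -[a]intz scaler_int zliftM IHy mul0rz addr0.
Qed.

Lemma qliftD : {morph qlift f : x y / x + y}.
Proof.
move=> x y; case: (qprojK x) => x' <-; case: (qprojK y) => y' <-.
by rewrite -qprojD !qliftE zliftD.
Qed.

Lemma qliftB : {morph qlift f : x y / x - y}.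
Proof.
move=> x y; case: (qprojK x) => x' <-; case: (qprojK y) => y' <-.
by rewrite -qprojB !qliftE zliftB.
Qed.

End Lift.

Section Theta.
Variables (R : comNzRingType) (M : lmodType R) (Lam : M -> Prop).
Variables (N : zmodType) (iota : {additive N -> M}).

Definition theta_simplex (n : N) (u : 3.-tuple M) : ext3 M :=
  wedge3 (iota n) (u`_1 - u`_0) (u`_2 - u`_0).

Definition theta_chain (n : N) : chains Lam 2 -> ext3 M :=
  qlift (theta_simplex n).

Definition theta : tensor N (chains Lam 2) -> ext3 M :=
  qlift (fun nc => theta_chain nc.1 nc.2).

Lemma theta_translate n x : translate_rel Lam x -> zlift (theta_simplex n) x = 0.
Proof.
case=> l u _; rewrite zliftB !zliftU /theta_simplex.
pose v := [tuple tnth u i + l | i < 3].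
have nthv (i : 'I_3) : v`_i = u`_i + l.
  by rewrite -tnth_nth tnth_mktuple (tnth_nth 0).
rewrite -/v (nthv 0) (nthv 1) (nthv (@Ordinal 3 2 isT)).
have dl (y z : M) : y + l - (z + l) = y - z.
  by rewrite opprD addrACA subrr addr0.
by rewrite !dl subrr.
Qed.

Lemma theta_chain_simplex n u :
  theta_chain n (simplex Lam u) = theta_simplex n u.
Proof. by rewrite /theta_chain qliftE ?zliftU// => x; apply: theta_translate. Qed.

Lemma theta_chainDr n : {morph theta_chain n : c c' / c + c'}.
Proof. by apply: qliftD => x; apply: theta_translate. Qed.

Lemma theta_chainDl n n' c :
  theta_chain (n + n') c = theta_chain n c + theta_chain n' c.
Proof.
case: (qprojK c) => x <-; rewrite /theta_chain !qliftE; try exact: theta_translate.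
rewrite /zlift -[x]Freeg_enum !fglift_Freeg /prelift.
rewrite -big_split /=; apply: eq_bigr => -[a u] _ /=.
have -> : theta_simplex (n + n') u = theta_simplex n u + theta_simplex n' u.
  rewrite /theta_simplex raddfD.
  by rewrite -[iota n in LHS]scale1r wedge3_lin1 scale1r.
exact: (@scalerDr _ (zmodule (ext3 M))).
Qed.

Lemma theta_bilinear x : tensor_rel x ->
  zlift (fun nc : N * chains Lam 2 => theta_chain nc.1 nc.2) x = 0.
Proof.
by case=> *; rewrite zliftB zliftD !zliftU /= ?theta_chainDl ?theta_chainDr subrr.
Qed.

Lemma theta_tens n c : theta (tens n c) = theta_chain n c.
Proof. by rewrite /theta qliftE ?zliftU//; apply: theta_bilinear. Qed.

Lemma thetaD : {morph theta : x y / x + y}.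
Proof. exact: qliftD theta_bilinear. Qed.

Lemma thetaE n u0 u1 u2 :
  theta (tens n (simplex Lam [tuple u0; u1; u2]))
    = wedge3 (iota n) (u1 - u0) (u2 - u0).
Proof. by rewrite theta_tens theta_chain_simplex. Qed.

End Theta.

Section Hom.
Variables (U : zmodType) (S : comNzRingType).

Definition is_hom : {pred U -> S^o} := fun f => `[< zmod_morphism f >].

Lemma is_hom_submod_closed : submod_closed is_hom.
Proof.
split=> [|a f f' /asboolP hf /asboolP hf']; apply/asboolP => x y.
  by rewrite /= subrr.
rewrite -[LHS]/(a * f (x - y) + f' (x - y)) hf hf' mulrBr addrACA -opprD.
by [].
Qed.

HB.instance Definition _ := GRing.isSubmodClosed.Build S (U -> S^o) is_hom
  is_hom_submod_closed.

Record hom := Hom { hom_fun :> U -> S^o; _ : is_hom hom_fun }.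

HB.instance Definition _ := [isSub for hom_fun].
HB.instance Definition _ := [Choice of hom by <:].
HB.instance Definition _ := [SubChoice_isSubLmodule of hom by <:].

Lemma mk_hom_subproof (f : U -> S^o) : zmod_morphism f -> is_hom f.
Proof. by move=> hf; apply/asboolP. Qed.

Definition mk_hom (f : U -> S^o) (hf : zmod_morphism f) : hom :=
  Hom (mk_hom_subproof hf).

Lemma hom_zmod_morphism (f : hom) : zmod_morphism f.
Proof. by case: f => f hf; apply/asboolP. Qed.

End Hom.

(* Loops and parallel edges are allowed; the order of the two ends of an edge
   carries no meaning, orientations being chosen separately. *)
Record multigraph := Multigraph {
  vert : finType;
  edge : finType;
  ends : edge -> vert * vert }.

Section Walks.
Variable G : multigraph.

(* An edge with a direction of traversal: [(e, false)] goes from [(ends e).1] to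
   [(ends e).2], and [(e, true)] the other way. *)
Definition dart : Type := edge G * bool.
HB.instance Definition _ := Finite.on dart.

Definition dsrc (d : dart) := if d.2 then (ends d.1).2 else (ends d.1).1.
Definition dtgt (d : dart) := if d.2 then (ends d.1).1 else (ends d.1).2.

Fixpoint walk (x : vert G) (w : seq dart) (y : vert G) : bool :=
  if w is d :: w' then (dsrc d == x) && walk (dtgt d) w' y else x == y.

Definition walk_edges (w : seq dart) : seq (edge G) := [seq d.1 | d <- w].

Definition walk_in (A : {pred edge G}) (w : seq dart) : bool :=
  all (mem A) (walk_edges w).

Definition simple_path x w y := walk x w y && uniq (x :: [seq dtgt d | d <- w]).

(* Distinctness of the edges rules out traversing an edge back and forth. *)
Definition simple_cycle x w :=
  [&& w != [::], walk x w x, uniq [seq dtgt d | d <- w] & uniq (walk_edges w)].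

Definition connected_graph := forall x y, exists w, walk x w y.

Definition spanning_tree (T : {set edge G}) :=
  (forall x y, exists2 w, walk x w y & walk_in T w) /\
  (forall x w, simple_cycle x w -> ~~ walk_in T w).

(* Subtraction is truncated, but [#|vert G| <= #|edge G| + 1] when [G] is
   connected. *)
Definition genus : nat := #|edge G| + 1 - #|vert G|.

Definition complement_labelling (T : {set edge G}) (lab : 'I_genus -> edge G) :=
  injective lab /\ forall e, (e \notin T) = (e \in codom lab).

End Walks.

Section Homology.
Variable G : multigraph.

(* [(e, o e)] is the positively oriented dart of the edge [e]. *)
Definition orientation := {ffun edge G -> bool}.

Definition flip_edge (o : orientation) (e : edge G) : orientation :=
  [ffun e' => if e' == e then ~~ o e' else o e'].

(* A 1-chain is given by its coordinates on the positively oriented edges. *)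
Definition chain1 := {ffun edge G -> int}.
HB.instance Definition _ := GRing.Zmodule.on chain1.

Definition edge_chain (e : edge G) : chain1 := [ffun e' => (e' == e)%:R].

Variable o : orientation.

Definition dart_chain (d : dart G) : chain1 :=
  if d.2 == o d.1 then edge_chain d.1 else - edge_chain d.1.

Definition walk_chain (w : seq (dart G)) : chain1 := \sum_(d <- w) dart_chain d.

Definition boundary (c : chain1) : {ffun vert G -> int} :=
  [ffun x => \sum_e c e *
     ((dtgt (e, o e) == x)%:R - (dsrc (e, o e) == x)%:R)].

Definition is_cycle : {pred chain1} := fun c => boundary c == 0.

Lemma boundaryB : {morph boundary : c c' / c - c'}.
Proof.
move=> c c'; apply/ffunP => x; rewrite !ffunE -sumrB.
by apply: eq_bigr => e _; rewrite !ffunE mulrBl.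
Qed.

Lemma is_cycle_zmod_closed : zmod_closed is_cycle.
Proof.
have b0 : boundary 0 = 0 by rewrite -(subrr 0) boundaryB subrr.
split=> [|c c' /eqP hc /eqP hc']; first by rewrite unfold_in b0.
by rewrite unfold_in boundaryB hc hc' subrr.
Qed.

HB.instance Definition _ := GRing.isZmodClosed.Build chain1 is_cycle
  is_cycle_zmod_closed.

Record H1 := Cycle { cycle_chain :> chain1; _ : is_cycle cycle_chain }.
HB.instance Definition _ := [isSub for cycle_chain].
HB.instance Definition _ := [Choice of H1 by <:].
HB.instance Definition _ := [SubChoice_isSubZmodule of H1 by <:].

Lemma boundary_dart d x :
  boundary (dart_chain d) x = (dtgt d == x)%:R - (dsrc d == x)%:R.
Proof.
rewrite ffunE (bigD1 d.1) //= big1 ?addr0 => [|e ne_ed]; last first.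
  rewrite /dart_chain; case: ifP => _; rewrite !ffunE (negPf ne_ed) mulr0n.
    by rewrite mul0r.
  by rewrite oppr0 mul0r.
case: d => e b; rewrite /dart_chain /=; case: eqVneq => [->|].
  by rewrite ffunE eqxx mul1r.
by rewrite !ffunE eqxx mulN1r opprB /dsrc /dtgt /=; case: b (o e) => -[].
Qed.

Lemma boundary_walk x w y z : walk x w y ->
  boundary (walk_chain w) z = (y == z)%:R - (x == z)%:R.
Proof.
have bD c c' : boundary (c + c') = boundary c + boundary c'.
  apply/ffunP => t; rewrite !ffunE -big_split.
  by apply: eq_bigr => e _; rewrite !ffunE mulrDl.
rewrite /walk_chain; elim: w x => [|d w IHw] x /=.
  move/eqP->; rewrite big_nil subrr ffunE big1 // => e _.
  by rewrite ffunE mul0r.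
case/andP => /eqP <- /IHw IH; rewrite big_cons bD ffunE IH boundary_dart.
by rewrite addrC subrKA.
Qed.

Lemma closed_walk_cycle x w : walk x w x -> is_cycle (walk_chain w).
Proof.
move=> ww; apply/eqP/ffunP => z.
by rewrite (boundary_walk z ww) subrr ffunE.
Qed.

(* [N = H^1(G, Z)], as the dual of the free abelian group [H_1(G, Z)]. *)
Definition cohomology := hom H1 int.
HB.instance Definition _ := GRing.Lmodule.on cohomology.

(* Z[x_e : e in E(G)], the variables being numbered by [enum_rank]. *)
Definition edge_ring := {mpoly int[#|edge G|]}.
HB.instance Definition _ := GRing.ComNzRing.on edge_ring.

Definition xvar (e : edge G) : edge_ring := 'X_(enum_rank e).

(* [N_R = R (x) N], identified with [Hom(H_1(G, Z), R)]. *)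
Definition cohomologyR := hom H1 edge_ring.
HB.instance Definition _ := GRing.Lmodule.on cohomologyR.

Definition pairing (c c' : chain1) : edge_ring :=
  \sum_e (c e * c' e)%:~R * xvar e.

Lemma pairing_edge e c : pairing (edge_chain e) c = (c e)%:~R * xvar e.
Proof.
rewrite /pairing (bigD1 e) //= big1 ?addr0 => [|e' ne]; rewrite ffunE.
  by rewrite eqxx mul1r.
by rewrite (negPf ne) !mul0r.
Qed.

Lemma pairing_zmod_morphism c :
  zmod_morphism (fun h : H1 => pairing c h : edge_ring^o).
Proof.
move=> h h'; rewrite /= /pairing -sumrB; apply: eq_bigr => e _.
by rewrite !ffunE mulrBr rmorphB mulrBl.
Qed.

Definition pi_chain (c : chain1) : cohomologyR :=
  mk_hom (pairing_zmod_morphism c).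

Definition period_lattice (u : cohomologyR) : Prop :=
  exists h : H1, u = pi_chain h.

Lemma extend_zmod_morphism (n : cohomology) :
  zmod_morphism (fun h : H1 => (n h : int)%:~R : edge_ring^o).
Proof. by move=> h h'; rewrite hom_zmod_morphism rmorphB. Qed.

Definition extend_scalars (n : cohomology) : cohomologyR :=
  mk_hom (extend_zmod_morphism n).

Lemma extend_scalars_zmod_morphism : zmod_morphism extend_scalars.
Proof.
move=> n n'; apply/val_inj/funext => h.
rewrite raddfB; exact: (rmorphB (intr : int -> edge_ring)).
Qed.

HB.instance Definition _ :=
  GRing.isZmodMorphism.Build cohomology cohomologyR extend_scalars
    extend_scalars_zmod_morphism.

Definition jac_chains (q : nat) := chains period_lattice q.
HB.instance Definition _ q := GRing.Lmodule.on (jac_chains q).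

Definition jac_chains12 := tensor cohomology (jac_chains 2).
HB.instance Definition _ := GRing.Lmodule.on jac_chains12.

Definition Theta : jac_chains12 -> ext3 cohomologyR :=
  @theta _ _ period_lattice _ extend_scalars.

End Homology.

Section Upsilon.
Variables (G : multigraph) (o : orientation G) (v : vert G).
Variables (T : {set edge G}) (lab : 'I_(genus G) -> edge G).

(* The cycles gamma_i and the paths delta_i, traversed as walks; gamma_i starts
   at the vertex p_{i,0} where delta_i ends. *)
Record fundamental_system := FundamentalSystem {
  cyc_base : 'I_(genus G) -> vert G;
  cyc : 'I_(genus G) -> seq (dart G);
  stem : 'I_(genus G) -> seq (dart G);
  cyc_simple i : simple_cycle (cyc_base i) (cyc i);
  cyc_in i : walk_in (lab i |: T) (cyc i);
  cyc_pos i : 0 < walk_chain o (cyc i) (lab i);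
  stem_simple i : simple_path v (stem i) (cyc_base i);
  stem_in i : walk_in T (stem i);
  stem_disjoint i : ~~ has (mem (walk_edges (cyc i))) (walk_edges (stem i)) }.

Variable D : fundamental_system.
Implicit Types (i j k : 'I_(genus G)) (e : edge G).

Lemma cyc_is_cycle i : is_cycle o (walk_chain o (cyc D i)).
Proof. by case/and4P: (cyc_simple D i) => _ + _ _; apply: closed_walk_cycle. Qed.

Definition gamma i : H1 o := Cycle (cyc_is_cycle i).

Definition delta i : chain1 G := walk_chain o (stem D i).

(* By [pairing_edge], these are x_e^-1 [e, gamma_i] and x_e^-1 [e, delta_i]. *)
Definition f_ind i e : int := cycle_chain (gamma i) e.
Definition g_ind i e : int := delta i e.

Definition cyc_edges i : seq (edge G) := walk_edges (cyc D i).

Definition h_ind i e e' : int :=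
  if [|| e \notin cyc_edges i, e' \notin cyc_edges i | e == e'] then 0
  else if (index e (cyc_edges i) < index e' (cyc_edges i))%N then 1 else -1.

Definition cyc_size i : nat := size (cyc_edges i).

Definition upoint i (j : nat) : cohomologyR o :=
  pi_chain o (delta i + \sum_(e <- take j (cyc_edges i)) edge_chain e *~ f_ind i e).

Definition tri (u0 u1 u2 : cohomologyR o) : jac_chains o 2 :=
  simplex (@period_lattice G o) [tuple u0; u1; u2].

Definition Upsilon_ i : jac_chains o 2 :=
  let u := upoint i in
  let n := cyc_size i in
  \sum_(1 <= j < n) (tri (u 0%N) (u j) (u j.+1) + tri (- u 0%N) (- u j) (- u j.+1))
  + tri (u 0%N) (u n) (- u 0%N) + tri (u 0%N) (- u 0%N) (- u n)
  - \sum_(j < n | f_ind i (tnth (in_tuple (cyc_edges i)) j) == -1)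
      (tri (u j) (u j.+1) (u j) + tri (u j) (u j) (u j)
       + tri (- u j) (- u j.+1) (- u j) + tri (- u j) (- u j) (- u j)).

Definition dual_basis (eps : 'I_(genus G) -> cohomology o) :=
  forall i j, eps i (gamma j) = (i == j)%:R.

Definition Upsilon (eps : 'I_(genus G) -> cohomology o) : jac_chains12 o :=
  \sum_i tens (eps i) (Upsilon_ i).

Definition linked i j k e e' : bool :=
  [&& e \in cyc_edges i, e' \in cyc_edges i,
      e \in cyc_edges j, e' \notin cyc_edges j,
      e \notin cyc_edges k & e' \in cyc_edges k].

End Upsilon.

Definition edge_pair_reps (E : finType) (S : {set E * E}) :=
  (forall e, (e, e) \notin S) /\
  (forall e e', e != e' -> ((e, e') \in S) (+) ((e', e) \in S)).

Definition triple_reps (I : finType) (S' : {set 3.-tuple I}) :=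
  (forall t, t \in S' -> uniq t) /\
  (forall t : 3.-tuple I, uniq t -> #|[set t' in S' | perm_eq t' t]| = 1%N).

Definition permute3 (I : Type) (s : 'S_3) (t : 3.-tuple I) : 3.-tuple I :=
  [tuple tnth t (s x) | x < 3].

(* Main.v *)
(* Expanding Theta, the degenerate simplices vanish and the i-th summand becomes the
   sum over S of w_i(e, e') eps_i /\ pi(e) /\ pi(e'), where
     w_i(e, e') = 2 f_i(e) f_i(e') h_i(e, e') + 4 g_i(e) f_i(e') - 4 g_i(e') f_i(e).
   Since pi(e) = x_e sum_j f_j(e) eps_j, the coefficient of eps_i /\ eps_j /\ eps_k is
   the 3 x 3 determinant with rows (w, f(e), f(e')) taken at i, j, k. Fundamental cycles
   are determined by T, so two cycles containing the same ones among e, e' have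
   proportional rows: both cross the pieces of T - e - e' in the same way, up to
   reversal, and the position of the basepoint v among these pieces fixes the order in
   which they meet e and e'. A nonzero determinant therefore forces the three cycles to
   contain respectively both edges, only e, and only e'; its value is then
   2 f_i(e) f_j(e) f_k(e') times a sign depending only on T, v, e and e', from which the
   effect of reversing a cycle is read off. *)
From Pilot Require Import Defs.
From HB Require Import structures.
From mathcomp Require Import all_boot all_order all_algebra all_fingroup.
From mathcomp Require Import boolp functions.
From mathcomp Require Import freeg mpoly.
From mathcomp Require Import ring zify.

Set Implicit Arguments.
Unset Strict Implicit.
Unset Printing Implicit Defensive.

Import Order.TTheory GRing.Theory Num.Theory.
Local Open Scope ring_scope.

(** * Cycles supported on a spanning tree *)

Section WalkChains.
Variables (G : multigraph) (o : orientation G).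
Implicit Types (e : edge G) (d : dart G) (w : seq (dart G)) (x y z : vert G).

Lemma walk_cat x w1 w2 y :
  walk x (w1 ++ w2) y -> exists2 z, walk x w1 z & walk z w2 y.
Proof.
elim: w1 x => [|d w1 IH] x /=; first by exists x.
by case/andP=> -> /IH[z h1 h2]; exists z.
Qed.

Lemma walk_chain_cons d w :
  walk_chain o (d :: w) = dart_chain o d + walk_chain o w.
Proof. by rewrite /walk_chain big_cons. Qed.

Lemma dart_chainE d e :
  dart_chain o d e = if d.1 == e then (-1) ^+ (d.2 != o e) else 0.
Proof.
rewrite /dart_chain; case: (eqVneq d.1 e) => [<-|ne]; last first.
  by case: (_ == _); rewrite !ffunE eq_sym (negPf ne) ?oppr0.
by case: (_ == _); rewrite !ffunE eqxx.
Qed.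

Lemma walk_chain_notin w e : e \notin walk_edges w -> walk_chain o w e = 0.
Proof.
elim: w => [|d w IH]; first by rewrite /walk_chain big_nil ffunE.
rewrite inE negb_or walk_chain_cons ffunE => /andP[ne /IH->].
by rewrite dart_chainE eq_sym (negPf ne).
Qed.

Lemma walk_chain_in w d : uniq (walk_edges w) -> d \in w ->
  walk_chain o w d.1 = (-1) ^+ (d.2 != o d.1).
Proof.
elim: w => //= d' w IH /andP[nd uw]; rewrite inE walk_chain_cons ffunE.
case: eqVneq => [->|_ /= dw]; first by rewrite walk_chain_notin // dart_chainE eqxx addr0.
rewrite IH // dart_chainE; case: eqVneq => [e|]; last by rewrite add0r.
by move: nd; rewrite e /walk_edges map_f.
Qed.

Lemma walk_chain_mem w e : uniq (walk_edges w) ->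
  (e \in walk_edges w) = (walk_chain o w e != 0).
Proof.
move=> uw; apply/idP/idP; last by apply: contraR => /walk_chain_notin->.
by case/mapP => d dw ->; rewrite walk_chain_in // signr_eq0.
Qed.

Lemma walk_chain_sqr w e : uniq (walk_edges w) -> e \in walk_edges w ->
  walk_chain o w e ^+ 2 = 1.
Proof. by move=> uw /mapP[d dw ->]; rewrite walk_chain_in // sqrr_sign. Qed.

Lemma boundaryD : {morph boundary o : c c' / c + c'}.
Proof.
move=> c c'; apply/ffunP => x; rewrite !ffunE -big_split.
by apply: eq_bigr => e _; rewrite !ffunE mulrDl.
Qed.

Definition flow (c : chain1 G) d : int := if d.2 == o d.1 then c d.1 else - c d.1.

Definition outflow (c : chain1 G) x d := (0 < flow c d) && (dsrc d == x).

(** If no positive dart left [dtgt d], every summand of the boundary there would be nonnegative,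
    hence zero; but [d], then not a loop, contributes a positive one. *)
Lemma flow_continues c d : is_cycle o c -> 0 < flow c d ->
  exists d', outflow c (dtgt d) d'.
Proof.
move=> /eqP/ffunP/(_ (dtgt d)); rewrite !ffunE => cyc0 pd.
set y := dtgt d in cyc0 *.
apply/existsP; apply: contraT; rewrite negb_exists => /forallP no.
have nonneg e : 0 <= c e * ((dtgt (e, o e) == y)%:R - (dsrc (e, o e) == y)%:R).
  have := no (e, o e); have := no (e, ~~ o e).
  rewrite /outflow /flow /= eqxx; have -> : (~~ o e == o e) = false by case: (o e).
  have -> : dsrc (e, ~~ o e) = dtgt (e, o e) by rewrite /dsrc /dtgt /=; case: (o e).
  rewrite oppr_gt0.
  by case: (dsrc _ == y); case: (dtgt _ == y); rewrite ?andbT ?andbF -?leNgt; lia.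
have := psumr_eq0P (fun e _ => nonneg e) cyc0 (erefl : xpredT d.1).
have := no d; rewrite /outflow pd /= => /negPf.
move: pd; rewrite /y /flow /dsrc /dtgt; case: d {y no cyc0 nonneg} => e b /=.
by case: b (o e) => -[] /=; rewrite eqxx => p0 -> /=; lia.
Qed.

Lemma flow_inj c d d' : 0 < flow c d -> 0 < flow c d' -> d.1 = d'.1 -> d = d'.
Proof.
case: d d' => e b [e' b'] /= + + ee'; rewrite /flow -{}ee' /=.
by case: b; case: b'; case: (o e) => //=; lia.
Qed.

(* Following the flow from vertex to vertex must eventually close up. *)
Lemma cycle_in_support c : is_cycle o c -> c != 0 ->
  exists x w, simple_cycle x w /\ {in walk_edges w, forall e, c e != 0}.
Proof.
move=> cc; rewrite -subr_eq0 subr0 => nz.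
have [d0 pd0] : exists d, 0 < flow c d.
  have [e ne] : exists e, c e != 0.
    apply/existsP; apply: contraNT nz; rewrite negb_exists => /forallP h.
    by apply/eqP/ffunP => e; rewrite ffunE; apply/eqP; rewrite -[_ == _]negbK h.
  case: (ltrgt0P (c e)) ne => // ce _.
    by exists (e, o e); rewrite /flow /= eqxx.
  exists (e, ~~ o e); rewrite /flow /=; have -> : (~~ o e == o e) = false by case: (o e).
  by rewrite oppr_gt0.
(* [F] picks an outgoing dart of positive flow; the default [d0] does not matter, since only [good]
   vertices are visited. *)
pose F x := odflt d0 [pick d | outflow c x d]; pose nv x := dtgt (F x).
pose good x := [exists d, outflow c x d].
have goodF x : good x -> outflow c x (F x).
  by rewrite /F; case: pickP => // no /existsP[d]; rewrite no.
have good_nv x : good x -> good (nv x).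
  by move/goodF/andP => [p _]; apply/existsP/flow_continues.
have good_iter n x : good x -> good (iter n nv x) by move=> gx; elim: n => //= n /good_nv.
have gx0 : good (dtgt d0) by apply/existsP/flow_continues.
(* The iterates of [nv] revisit a vertex; discarding the [i] steps before it leaves a closed orbit
   of [k.+1] distinct vertices. *)
have /trajectP[i lt_i] := looping_order nv (dtgt d0).
have := orbit_uniq nv (dtgt d0); rewrite /fingraph.orbit.
move: (fingraph.order _ _) lt_i => n lt_i /[swap].
rewrite -(subnK lt_i) addnS -addSn iterD addnC trajectD cat_uniq.
move: {n lt_i}(n - i.+1)%N => k iy /and3P[_ _].
set y := iter i nv (dtgt d0); have gy : good y by exact: good_iter.
rewrite -/y in iy; move=> uy.
have gt : {in traject nv y k.+1, forall x, good x}.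
  by move=> x /trajectP[j _ ->]; apply: good_iter.
exists y, [seq F x | x <- traject nv y k.+1]; split; last first.
  move=> _ /mapP[_ /mapP[x /gt/goodF/andP[+ _] ->] ->].
  by rewrite /flow; case: ifP => _; [rewrite lt0r => /andP[]|
    rewrite oppr_gt0 lt_neqAle => /andP[]].
apply/and4P; split=> //.
- have wk m z : good z -> walk z [seq F x | x <- traject nv z m] (iter m nv z).
    elim: m z => [|m IH] z gz //=.
    case/andP: (goodF z gz) => _ ->; rewrite -iterS iterSr.
    by apply: IH; apply: good_nv.
  by rewrite -[X in walk _ _ X]iy; apply: wk.
- rewrite -map_comp -[map _ _]/(map nv _).
  have -> m z : map nv (traject nv z m) = traject nv (nv z) m.
    by elim: m z => //= m IH z; rewrite IH.
  rewrite trajectSr -iterSr iy -(rot1_cons y) rot_uniq.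
  by rewrite -trajectS.
(* A common edge forces a common direction of positive flow, hence a common source. *)
- rewrite /walk_edges -map_comp map_inj_in_uniq // => x x' xt xt' /= ee.
  case/andP: (goodF x (gt x xt)) => p /eqP <-.
  case/andP: (goodF x' (gt x' xt')) => p' /eqP <-.
  by rewrite (flow_inj p p' ee).
Qed.

(** A nonzero cycle would have a simple cycle in its support, hence inside [T]. Identities between
    cycles can thus be checked off [T]. *)
Lemma tree_cycle_eq0 (T : {set edge G}) c : spanning_tree T -> is_cycle o c ->
  (forall e, e \notin T -> c e = 0) -> c = 0.
Proof.
move=> [_ acyc] cc supp; apply: contraTeq isT => nz.
have [x [w [sw wc]]] := cycle_in_support cc nz.
have /negP[] := acyc x w sw; apply/allP => e /wc; apply: contraR => eT.
by rewrite supp.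
Qed.

End WalkChains.

(** * Fundamental cycles and the coefficients *)

Section TreePotential.
Variables (G : multigraph) (v : vert G) (T : {set edge G}).
Variable tree_walk : vert G -> seq (dart G).
Hypothesis tree_walkP : forall x, walk v (tree_walk x) x.
Hypothesis tree_walk_in : forall x, walk_in T (tree_walk x).
Hypothesis treeT : spanning_tree T.
Implicit Types (o : orientation G) (e : edge G) (d : dart G) (x y : vert G).

(* For [e] in [T] this is, up to a sign, the indicator of the component of
   [T - e] not containing [v]. *)
Definition tree_coef o e x : int := walk_chain o (tree_walk x) e.

Lemma walk_in_chain0 o w e : walk_in T w -> e \notin T -> walk_chain o w e = 0.
Proof. by move=> /allP wT eT; apply: walk_chain_notin; apply: contra eT => /wT. Qed.

(** The walk to [x], then [w], then the walk to [y] reversed form a cycle supported on [T], hence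
    zero. In particular [tree_coef] does not depend on the chosen walks. *)
Lemma tree_coef_walk o e x w y : walk x w y -> walk_in T w ->
  tree_coef o e y = tree_coef o e x + walk_chain o w e.
Proof.
move=> wk wT; rewrite /tree_coef.
pose c := walk_chain o (tree_walk x) + walk_chain o w - walk_chain o (tree_walk y).
have/ffunP/(_ e) : c = 0.
  apply: (tree_cycle_eq0 treeT (o := o)) => [|e' eT].
    apply/eqP/ffunP => z; rewrite boundaryB boundaryD.
    have := boundary_walk o z wk; have := boundary_walk o z (tree_walkP x).
    have := boundary_walk o z (tree_walkP y).
    do 3!move: (boundary o _) => ?; rewrite !ffunE => -> -> ->.
    ring.
  by rewrite !ffunE !(walk_in_chain0 _ _ eT) // subrr.
by rewrite !ffunE => /eqP; rewrite subr_eq0 => /eqP.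
Qed.

Lemma tree_coef_root o e : tree_coef o e v = 0.
Proof.
have := tree_coef_walk o e (tree_walkP v) (tree_walk_in v).
by rewrite -/(tree_coef o e v) => /eqP; rewrite eq_sym -subr_eq0 addrK => /eqP.
Qed.

Lemma tree_coef_const o e x w y : walk x w y -> walk_in T w ->
  e \notin walk_edges w -> tree_coef o e y = tree_coef o e x.
Proof.
by move=> wk wT ew; rewrite (tree_coef_walk o e wk wT) walk_chain_notin ?addr0.
Qed.

Lemma tree_coef_dart o e d : d.1 \in T ->
  tree_coef o e (dtgt d) = tree_coef o e (dsrc d) + dart_chain o d e.
Proof.
move=> dT; rewrite (@tree_coef_walk o e (dsrc d) [:: d] (dtgt d)) /= ?eqxx //.
  by rewrite /walk_chain big_seq1.
by rewrite /walk_in /= dT.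
Qed.

(** * Fundamental cycles, their stems, and tree coefficients along them *)

Section Fundamental.
Variables (o : orientation G) (lab : 'I_(genus G) -> edge G).
Hypothesis labT : complement_labelling T lab.
Variable D : fundamental_system o v T lab.
Implicit Types (i j k : 'I_(genus G)).

Lemma lab_notin i : lab i \notin T.
Proof. by rewrite labT.2 codom_f. Qed.

Lemma cyc_uniq i : uniq (cyc_edges D i).
Proof. by case/and4P: (cyc_simple D i). Qed.

Lemma cyc_walk i : walk (cyc_base D i) (cyc D i) (cyc_base D i).
Proof. by case/and4P: (cyc_simple D i). Qed.

Lemma f_ind_notin i e : e \notin cyc_edges D i -> f_ind D i e = 0.
Proof. exact: walk_chain_notin. Qed.

Lemma f_ind_sqr i e : e \in cyc_edges D i -> f_ind D i e ^+ 2 = 1.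
Proof. by apply: walk_chain_sqr; apply: cyc_uniq. Qed.

Lemma f_ind_mem i e : (e \in cyc_edges D i) = (f_ind D i e != 0).
Proof. exact/walk_chain_mem/cyc_uniq. Qed.

(** The only edge of cycle [i] off [T] is [lab i]; its coefficient is a sign, which [cyc_pos] makes
    positive. *)
Lemma f_ind_lab i j : f_ind D i (lab j) = (i == j)%:R.
Proof.
case: eqVneq => [->|ne].
  have := cyc_pos D j; rewrite -[walk_chain _ _ _]/(f_ind D j (lab j)) => pos.
  have : lab j \in cyc_edges D j by rewrite f_ind_mem gt_eqF.
  by move=> /f_ind_sqr/eqP; rewrite sqrf_eq1 => /orP[] /eqP E //; rewrite E in pos.
apply: f_ind_notin; apply/negP => /(allP (cyc_in D i)).
rewrite /= !inE (negPf (lab_notin j)) orbF => /eqP/labT.1 ji.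
by rewrite ji eqxx in ne.
Qed.

Lemma cyc_edge_tree i e : e \in cyc_edges D i -> (e == lab i) || (e \in T).
Proof. by move/(allP (cyc_in D i)); rewrite /= !inE. Qed.

Lemma shared_edge_in i j e : i != j ->
  e \in cyc_edges D i -> e \in cyc_edges D j -> e \in T.
Proof.
move=> ne /cyc_edge_tree/orP[/eqP ->|//]; rewrite f_ind_mem f_ind_lab.
by move: ne; rewrite (eq_sym i) => /negPf ->.
Qed.

(** Both sides are cycles with equal coefficients off [T]: the fundamental cycles span the
    homology. *)
Lemma cycle_lab_combination (c : chain1 G) : is_cycle o c ->
  c = \sum_i walk_chain o (cyc D i) *~ c (lab i).
Proof.
move=> cc; apply/eqP; rewrite -subr_eq0; apply/eqP.
apply: (tree_cycle_eq0 treeT (o := o)) => [|e eT].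
  apply: (@rpredB _ (is_cycle o)) => //.
  by apply: rpred_sum => i _; apply: rpredMz; apply: cyc_is_cycle.
have /codomP[j ->] : e \in codom lab by rewrite -labT.2.
rewrite !ffunE sum_ffunE (bigD1 j) //= big1 => [|i ne].
  by rewrite ffunMzE -/(f_ind D j (lab j)) f_ind_lab eqxx addr0 intz subrr.
by rewrite ffunMzE -/(f_ind D i (lab j)) f_ind_lab (negPf ne) mul0rz.
Qed.

Lemma g_ind_tree_coef i e : g_ind D i e = tree_coef o e (cyc_base D i).
Proof.
case/andP: (stem_simple D i) => wk _.
by rewrite (tree_coef_walk o e wk (stem_in D i)) tree_coef_root add0r.
Qed.

Lemma tree_coef_base0 i e : e \in cyc_edges D i -> tree_coef o e (cyc_base D i) = 0.
Proof.
move=> ei; rewrite -g_ind_tree_coef; apply: walk_chain_notin.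
by apply: contraL ei => es; have /hasPn/(_ e es) := stem_disjoint D i.
Qed.

(** The edge [lab i] occurs at most once on the cycle, so [w1] or [w2] stays in [T]; neither crosses
    [e], so the coefficient is constant along that one. *)
Lemma tree_coef_cyc_split i e w1 w2 x : e \notin cyc_edges D i ->
  cyc D i = w1 ++ w2 -> walk (cyc_base D i) w1 x -> walk x w2 (cyc_base D i) ->
  tree_coef o e x = tree_coef o e (cyc_base D i).
Proof.
rewrite /cyc_edges => + cE k1 k2; rewrite cE /walk_edges map_cat mem_cat negb_or.
move=> /andP[e1 e2].
have inT w : {subset w <= cyc D i} -> lab i \notin walk_edges w -> walk_in T w.
  move=> sub nl; apply/allP => _ /mapP[d dw ->] /=.
  have := @cyc_edge_tree i d.1; rewrite map_f ?sub // => /(_ isT)/orP[/eqP dl|//].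
  by move: nl; rewrite -dl map_f.
have := cyc_uniq i; rewrite /cyc_edges cE /walk_edges map_cat cat_uniq.
case/and3P=> _ /hasPn dis _.
have [l1|l1] := boolP (lab i \in walk_edges w1).
  rewrite -(tree_coef_const o k2) //; apply: inT; last first.
    by apply: contraL l1; apply: dis.
  by move=> d; rewrite cE mem_cat => ->; rewrite orbT.
rewrite (tree_coef_const o k1) //; apply: inT => //.
by move=> d; rewrite cE mem_cat => ->.
Qed.

Lemma tree_coef_cyc i e e' b : e \notin cyc_edges D i -> e' \in cyc_edges D i ->
  tree_coef o e (dsrc (e', b)) = tree_coef o e (cyc_base D i).
Proof.
move=> nei /mapP[[e1 b'] dc /= ->].
have [w1 [w2 cE]] : exists w1 w2, cyc D i = w1 ++ (e1, b') :: w2.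
  by case/splitPr: dc => w1 w2; exists w1, w2.
have := cyc_walk i; rewrite cE => /walk_cat[x k1 /= /andP[/eqP sx k2]].
have hs : tree_coef o e (dsrc (e1, b')) = tree_coef o e (cyc_base D i).
  by apply: (tree_coef_cyc_split nei cE); rewrite /= sx ?eqxx.
have ht : tree_coef o e (dtgt (e1, b')) = tree_coef o e (cyc_base D i).
  apply: (@tree_coef_cyc_split i e (rcons w1 (e1, b')) w2) => //.
    by rewrite cat_rcons.
  by elim: (w1) (cyc_base D i) k1 => [|d w IH] z /= => [/eqP ->|/andP[-> /IH]];
    rewrite ?sx ?eqxx.
by move: hs ht; rewrite /dsrc /dtgt /=; clear; case: b; case: b'.
Qed.

(** * The order in which a cycle meets two tree edges *)

Lemma cyc_split2 i e e' : e \in cyc_edges D i -> e' \in cyc_edges D i ->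
  (index e (cyc_edges D i) < index e' (cyc_edges D i))%N ->
  exists w1 b w2 b' w3, cyc D i = w1 ++ (e, b) :: w2 ++ (e', b') :: w3.
Proof.
rewrite /cyc_edges /walk_edges => /mapP[[e1 b] dc /= ->].
have := cyc_uniq i; rewrite /cyc_edges /walk_edges.
case/splitPr: dc => w1 w; rewrite map_cat cat_uniq /= negb_or.
case/and3P=> _ /andP[ne1 _] _; rewrite mem_cat inE !index_cat (negPf ne1) /= eqxx addn0.
case: ifP => [e1' _|_ /=]; first by rewrite ltnNge index_size.
case: eqVneq => [->|_ /=]; first by rewrite ?eqxx ?addn0 ltnn.
move=> /mapP[[e2 b'] dc /= ->] _.
by case/splitPr: dc => w2 w3; exists w1, b, w2, b', w3.
Qed.

(** For [e] in [T] one end has coefficient 0 and the other 1 or -1, so this is 1 if the positive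
    direction of [e] points away from [v], and -1 otherwise. *)
Definition tree_sign e : int :=
  tree_coef o e (dsrc (e, false)) + tree_coef o e (dsrc (e, true)).

(** For distinct edges of [T] either end of [e'] gives the same value, nonzero exactly when [e]
    separates [e'] from [v] in [T]. *)
Definition tree_side e e' : int := tree_coef o e (dsrc (e', false)).

(* Here [s], [s'] are the tree signs, [a] = [tree_side e e'], [b] = [tree_side e' e],
   and [f], [f'], [h] are the indicators of a cycle through both edges. The three
   cases correspond to the piece of [T - e - e'] containing [v]: the tree path from
   [v] to [e'] crosses [e], or the one to [e] crosses [e'], or [v] lies between them.
   That [f' h], [f h] and [f f'] do not depend on the cycle is the crux. *)
Definition cut_relation (s s' a b f f' h : int) : Prop :=
  [/\ s ^+ 2 = 1 /\ s' ^+ 2 = 1,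
      [\/ a = s /\ b = 0, a = 0 /\ b = s' | a = 0 /\ b = 0],
      f' * h = 2 * s * s' * a - s', f * h = s - 2 * s * s' * b
    & f * f' = 2 * s' * a + 2 * s * b - s * s'].

Definition cut_pattern e e' (f f' h : int) : Prop :=
  cut_relation (tree_sign e) (tree_sign e') (tree_side e e') (tree_side e' e) f f' h.

(* The cycle runs base, x, [e], y, z, [e'], t, base; the unprimed (primed)
   integers are the tree coefficients at [e] (at [e']) of these vertices, and
   at most one of the three remaining segments leaves the tree. *)
Lemma cut_relation_walk (f f' x x' y y' z z' t t' : int) :
  f ^+ 2 = 1 -> f' ^+ 2 = 1 -> y = x + f -> y' = x' -> t = z -> t' = z' + f' ->
  [\/ [/\ z = y, z' = y', t = 0 & t' = 0],
      [/\ x = 0, x' = 0, t = 0 & t' = 0]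
    | [/\ x = 0, x' = 0, z = y & z' = y'] ] ->
  cut_relation (x + y) (z' + t') z x' f f' 1.
Proof.
move=> /eqP + /eqP; rewrite !sqrf_eq1 => sf sf' -> -> -> ->.
(* One relation for each segment that may leave the tree: first, middle or last. *)
have [h1 h2 h3] : [/\ cut_relation (- f) (- f') 0 (- f') f f' 1,
    cut_relation f (- f') 0 0 f f' 1 & cut_relation f f' f 0 f f' 1].
  by move: sf sf' => /orP[] /eqP-> /orP[] /eqP->;
    split; split=> //; by [apply: Or31|apply: Or32|apply: Or33].
case=> -[E1 E2 E3 E4].
- have -> : x = - f by lia.
  have -> : x' = - f' by lia.
  have -> : z' = - f' by lia.
  have -> : z = 0 by lia.
  by rewrite addNr addr0 addNr addr0.
- have -> : z' = - f' by lia.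
  by rewrite E1 E2 E3 !add0r addNr addr0.
- by rewrite E3 E4 E1 E2 !add0r.
Qed.

(** Exchanging the edges swaps the first two cases and reverses the order on the cycle, hence the
    sign of [h]. *)
Lemma cut_patternC e e' f f' h :
  cut_pattern e e' f f' h -> cut_pattern e' e f' f (- h).
Proof.
rewrite /cut_pattern /cut_relation; case=> -[-> ->] ab E1 E2 E3; split=> //.
- by case: ab => -[-> ->]; [apply: Or32|apply: Or31|apply: Or33].
- by rewrite mulrN E2; ring.
- by rewrite mulrN E1; ring.
- by rewrite mulrC E3; ring.
Qed.

(** The edges cut the cycle into three segments, at most one of which contains [lab i]. The others
    are tree walks avoiding both edges, so the tree coefficients are constant along them; at the
    base these vanish. *)
Lemma cyc_cut_pattern_lt i e e' : e \in T -> e' \in T -> e != e' ->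
  e \in cyc_edges D i -> e' \in cyc_edges D i ->
  (index e (cyc_edges D i) < index e' (cyc_edges D i))%N ->
  cut_pattern e e' (f_ind D i e) (f_ind D i e') 1.
Proof.
move=> eT eT' ne ei ei' lt.
have [w1 [b [w2 [b' [w3 cE]]]]] := cyc_split2 ei ei' lt.
have := cyc_walk i; rewrite cE => /walk_cat[x1 k1 /= /andP[/eqP X1]].
case/walk_cat=> x2 k2 /= /andP[/eqP X2 k3].
have fd d : d \in cyc D i -> dart_chain o d d.1 = f_ind D i d.1.
  by move=> dc; rewrite dart_chainE eqxx -(@walk_chain_in _ o (cyc D i)) // cyc_uniq.
have fe : dart_chain o (e, b) e = f_ind D i e.
  by apply: (fd (e, b)); rewrite cE mem_cat inE eqxx orbT.
have fe' : dart_chain o (e', b') e' = f_ind D i e'.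
  by apply: (fd (e', b')); rewrite cE mem_cat inE mem_cat inE eqxx !orbT.
have S1 := tree_coef_dart o e (d := (e, b)) eT.
have S2 := tree_coef_dart o e' (d := (e, b)) eT.
have S3 := tree_coef_dart o e (d := (e', b')) eT'.
have S4 := tree_coef_dart o e' (d := (e', b')) eT'.
rewrite fe in S1; rewrite fe' in S4.
rewrite dart_chainE /= (negPf ne) addr0 in S2.
rewrite dart_chainE /= eq_sym (negPf ne) addr0 in S3.
have B1 := tree_coef_base0 ei; have B2 := tree_coef_base0 ei'.
have segT w x y : {subset w <= cyc D i} -> walk x w y ->
    e \notin walk_edges w -> e' \notin walk_edges w -> lab i \notin walk_edges w ->
    tree_coef o e y = tree_coef o e x /\ tree_coef o e' y = tree_coef o e' x.
  move=> sub kw nw nw' lw; have wT : walk_in T w.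
    apply/allP => _ /mapP[d dw ->] /=.
    have := @cyc_edge_tree i d.1; rewrite map_f ?sub // => /(_ isT)/orP[/eqP dl|//].
    by move: lw; rewrite -dl map_f.
  by rewrite !(@tree_coef_const _ _ x w y).
have sub1 : {subset w1 <= cyc D i} by move=> d; rewrite cE mem_cat => ->.
have sub2 : {subset w2 <= cyc D i}.
  by move=> d; rewrite cE mem_cat inE mem_cat => ->; rewrite !orbT.
have sub3 : {subset w3 <= cyc D i}.
  by move=> d; rewrite cE mem_cat inE mem_cat inE => ->; rewrite !orbT.
have G1 := segT _ _ _ sub1 k1; have G2 := segT _ _ _ sub2 k2.
have G3 := segT _ _ _ sub3 k3.
have := cyc_uniq i; rewrite /cyc_edges cE /walk_edges map_cat /= map_cat /=.
rewrite cat_uniq /= cat_uniq /= has_cat /= mem_cat inE !negb_or -!andbA.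
case/andP=> _ /andP[n1 /andP[/hasPn d12 /andP[n1' /andP[/hasPn d13]]]].
case/andP=> n2 /andP[_ /andP[n3 /andP[_ /andP[n2' /andP[/hasPn d23 /andP[n3' _]]]]]].
have := f_ind_sqr ei; have := f_ind_sqr ei'.
move: (f_ind D i e) (f_ind D i e') S1 S4 => f f' S1 S4 sf' sf.
(* Signs are symmetric in the two ends, and a side may be read at either end of the other edge, so
   the direction of traversal is irrelevant. *)
have Es : tree_sign e = tree_coef o e (dsrc (e, b)) + tree_coef o e (dtgt (e, b)).
  by rewrite /tree_sign /dsrc /dtgt; case: (b) => //=; rewrite addrC.
have Es' : tree_sign e' = tree_coef o e' (dsrc (e', b')) + tree_coef o e' (dtgt (e', b')).
  by rewrite /tree_sign /dsrc /dtgt; case: (b') => //=; rewrite addrC.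
have Ea : tree_side e e' = tree_coef o e (dsrc (e', b')).
  by move: S3; rewrite /tree_side /dsrc /dtgt; case: (b').
have Eb : tree_side e' e = tree_coef o e' (dsrc (e, b)).
  by move: S2; rewrite /tree_side /dsrc /dtgt; case: (b).
rewrite X1 X2 in S1 S2 S3 S4 Es Es' Ea Eb.
rewrite /cut_pattern Es Es' Ea Eb {Es Es' Ea Eb}.
apply: (cut_relation_walk sf sf' S1 S2 S3 S4); rewrite {f f' S1 S2 S3 S4 sf sf'}.
(* Locate [lab i]: in the first segment, in the middle one, or in neither. *)
have [l1|l1] := boolP (lab i \in walk_edges w1).
  apply: Or31; have /(G2 n2 n2')[-> ->] : lab i \notin walk_edges w2.
    by apply: contraL l1; apply: d12.
  have /(G3 n3 n3')[H3 H4] : lab i \notin walk_edges w3.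
    by apply: contraL l1; apply: d13.
  by rewrite -H3 -H4.
have [H1 H2] := G1 n1 n1' l1.
have [l2|l2] := boolP (lab i \in walk_edges w2).
  have /(G3 n3 n3')[H3 H4] : lab i \notin walk_edges w3.
    by apply: contraL l2; apply: d23.
  by apply: Or32; rewrite -H3 -H4 H1 H2.
by apply: Or33; have [-> ->] := G2 n2 n2' l2; rewrite H1 H2.
Qed.

Lemma h_indC i e e' : h_ind D i e' e = - h_ind D i e e'.
Proof.
rewrite /h_ind (eq_sym e'); case: eqVneq => [->|ne]; first by rewrite !orbT oppr0.
have [ei|_] := boolP (e \in _); last by rewrite orbT oppr0.
have [ei'|_] := boolP (e' \in _); last by rewrite oppr0.
rewrite /=; case: ltngtP => // E; case/eqP: ne.
by rewrite -[LHS](nth_index e ei) -E nth_index.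
Qed.

Lemma cyc_cut_pattern i e e' : e \in T -> e' \in T -> e != e' ->
  e \in cyc_edges D i -> e' \in cyc_edges D i ->
  cut_pattern e e' (f_ind D i e) (f_ind D i e') (h_ind D i e e').
Proof.
move=> eT eT' ne ei ei'.
have [lt|] := boolP (index e (cyc_edges D i) < index e' (cyc_edges D i))%N.
  rewrite /h_ind ei ei' (negPf ne) lt /=; exact: cyc_cut_pattern_lt.
move=> ge; have lt : (index e' (cyc_edges D i) < index e (cyc_edges D i))%N.
  rewrite ltn_neqAle leqNgt ge andbT; apply: contra ne => /eqP E.
  by rewrite -(nth_index e ei) -E nth_index.
rewrite -[h_ind _ _ _ _]opprK -h_indC.
apply: cut_patternC; rewrite {1}/h_ind ei ei' eq_sym (negPf ne) lt /=.
by apply: cyc_cut_pattern_lt => //; rewrite eq_sym.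
Qed.

(** * Weights and determinant coefficients *)

Definition weight i e e' : int :=
  2 * f_ind D i e * f_ind D i e' * h_ind D i e e'
  + 4 * g_ind D i e * f_ind D i e' - 4 * g_ind D i e' * f_ind D i e.

Definition coef_entry (c : 'I_3) i e e' : int :=
  [:: weight i e e'; f_ind D i e; f_ind D i e']`_c.

Definition coef (t : 3.-tuple 'I_(genus G)) e e' : int :=
  \det (\matrix_(c < 3, x < 3) coef_entry c (tnth t x) e e').

Lemma coefE i j k e e' : coef [tuple i; j; k] e e' =
  weight i e e' * (f_ind D j e * f_ind D k e' - f_ind D k e * f_ind D j e')
  - weight j e e' * (f_ind D i e * f_ind D k e' - f_ind D k e * f_ind D i e')
  + weight k e e' * (f_ind D i e * f_ind D j e' - f_ind D j e * f_ind D i e').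
Proof.
rewrite /coef (expand_det_row _ 0) !big_ord_recl big_ord0 /cofactor.
rewrite !(expand_det_row _ 0) !big_ord_recl !big_ord0 /cofactor !det_mx11 !mxE /=.
rewrite /coef_entry !(tnth_nth i) /= /bump /=; ring.
Qed.

Lemma coef_permute s t e e' : coef (permute3 s t) e e' = (-1) ^+ s * coef t e e'.
Proof.
rewrite /coef -[in RHS]odd_permV -[in RHS]det_perm mulrC -det_mulmx -col_permE.
by congr (\det _); apply/matrixP => c x; rewrite !mxE tnth_mktuple.
Qed.

Lemma weight_diag i e : weight i e e = 0.
Proof. by rewrite /weight /h_ind eqxx !orbT mulr0 add0r subrr. Qed.

(** Cycle [i] lies on one side of [e'], so [g_ind D i e'] can be read at [e]: apart from the factor
    [f_ind D i e], the weight no longer depends on [i]. *)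
Lemma weight_fst i e e' : e \in cyc_edges D i -> e' \notin cyc_edges D i ->
  weight i e e' = - 4 * tree_side e' e * f_ind D i e.
Proof.
move=> ei ei'; rewrite /weight (f_ind_notin ei') !g_ind_tree_coef.
rewrite -(tree_coef_cyc false ei' ei) -/(tree_side e' e); ring.
Qed.

Lemma weight_snd i e e' : e \notin cyc_edges D i -> e' \in cyc_edges D i ->
  weight i e e' = 4 * tree_side e e' * f_ind D i e'.
Proof.
move=> ei ei'; rewrite /weight (f_ind_notin ei) !g_ind_tree_coef.
rewrite -(tree_coef_cyc false ei ei') -/(tree_side e e'); ring.
Qed.

Lemma weight_both i e e' : e \in cyc_edges D i -> e' \in cyc_edges D i ->
  weight i e e' = 2 * f_ind D i e * f_ind D i e' * h_ind D i e e'.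
Proof.
move=> ei ei'; rewrite /weight !g_ind_tree_coef !tree_coef_base0 //.
by rewrite mulr0 !mul0r subr0 addr0.
Qed.

(* The pair of edges cuts the tree into at most three pieces, and two cycles
   containing the same ones among [e], [e'] cross these pieces alike up to
   orientation. *)
Lemma same_type_minors i j e e' : i != j -> e != e' ->
  (e \in cyc_edges D i) = (e \in cyc_edges D j) ->
  (e' \in cyc_edges D i) = (e' \in cyc_edges D j) ->
  [/\ weight i e e' * f_ind D j e = weight j e e' * f_ind D i e,
      weight i e e' * f_ind D j e' = weight j e e' * f_ind D i e'
    & f_ind D i e * f_ind D j e' = f_ind D j e * f_ind D i e'].
Proof.
move=> nij nee'.
have [ei|ei] := boolP (e \in cyc_edges D i); move/esym => ej;
have [ei'|ei'] := boolP (e' \in cyc_edges D i); move/esym => ej'.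
- have eT := shared_edge_in nij ei ej; have eT' := shared_edge_in nij ei' ej'.
  rewrite !weight_both //.
  have [_ _ hi _ ri] := cyc_cut_pattern eT eT' nee' ei ei'.
  have [_ _ hj _ rj] := cyc_cut_pattern eT eT' nee' ej ej'.
  (* The cut pattern expresses [f f'] and [f' h] by tree data alone, so they agree for both cycles;
     as each [f] squares to 1, the columns agree up to sign. *)
  have {}rj : f_ind D j e * f_ind D j e' = f_ind D i e * f_ind D i e' by rewrite ri rj.
  have {}hj : f_ind D j e' * h_ind D j e e' = f_ind D i e' * h_ind D i e e'.
    by rewrite hi hj.
  have si := f_ind_sqr ei; have sj := f_ind_sqr ej.
  have E : f_ind D i e * f_ind D j e' = f_ind D j e * f_ind D i e'.
    transitivity (f_ind D i e * f_ind D j e * (f_ind D j e * f_ind D j e')).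
      by rewrite -[LHS]mulr1 -sj; ring.
    by rewrite rj -[RHS]mulr1 -si; ring.
  split=> //.
  + transitivity (2 * f_ind D i e * f_ind D j e * (f_ind D i e' * h_ind D i e e')).
      by ring.
    by rewrite -hj; ring.
  + transitivity (2 * (f_ind D i e * f_ind D j e') * (f_ind D i e' * h_ind D i e e')).
      by ring.
    by rewrite E -hj; ring.
- move/negbT: ej' => ej'; rewrite !weight_fst // !(f_ind_notin ei') !(f_ind_notin ej').
  by split; ring.
- move/negbT: ej => ej; rewrite !weight_snd // !(f_ind_notin ei) !(f_ind_notin ej).
  by split; ring.
- rewrite /weight !(f_ind_notin ei') !(f_ind_notin (negbT ej')).
  by rewrite !(f_ind_notin ei) !(f_ind_notin (negbT ej)); split; ring.
Qed.

Lemma linked_neq i j k e e' : linked D i j k e e' ->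
  [/\ i != j, i != k, j != k & e != e'].
Proof.
case/and5P=> ei ei' ej ej' /andP[ek ek'].
split; [apply: contraNN ej'|apply: contraNN ek|apply: contraNN ek|apply: contraNN ej'];
by move=> /eqP <-.
Qed.

(** Each of the two edges lies on two distinct fundamental cycles. *)
Lemma linked_in i j k e e' : linked D i j k e e' -> e \in T /\ e' \in T.
Proof.
move=> lk; have [nij nik _ _] := linked_neq lk.
case/and5P: lk => ei ei' ej _ /andP[_ ek'].
by split; [apply: shared_edge_in nij ei ej|apply: shared_edge_in nik ei' ek'].
Qed.

(** As [f_ind D k e] and [f_ind D j e'] vanish, one product survives for each weight, and the
    weights of [j] and [k] reduce to their stem terms. *)
Lemma coef_linked i j k e e' : linked D i j k e e' ->
  coef [tuple i; j; k] e e' =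
    2 * f_ind D j e * f_ind D k e' *
      (f_ind D i e * f_ind D i e' * h_ind D i e e'
       + 2 * f_ind D i e * g_ind D j e' - 2 * f_ind D i e' * g_ind D k e).
Proof.
case/and5P=> ei ei' ej ej' /andP[ek ek']; rewrite coefE weight_both //.
rewrite (f_ind_notin ek) (f_ind_notin ej') weight_fst // weight_snd //.
rewrite !g_ind_tree_coef -(tree_coef_cyc false ej' ej) -(tree_coef_cyc false ek ek').
rewrite -/(tree_side e e') -/(tree_side e' e); ring.
Qed.

(** By the cut pattern the bracket is [f_ind D i e] times a factor independent of the cycles, so
    each cycle enters through a single sign. The range and the effect of reversal follow from this
    form. *)
Lemma coef_linked_tree i j k e e' : linked D i j k e e' ->
  coef [tuple i; j; k] e e' =
    2 * f_ind D i e * f_ind D j e * f_ind D k e' * (2 * tree_side e' e - tree_sign e').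
Proof.
move=> lk; have [_ _ _ nee'] := linked_neq lk; have [eT eT'] := linked_in lk.
rewrite (coef_linked lk); case/and5P: lk => ei ei' ej ej' /andP[ek ek'].
rewrite !g_ind_tree_coef -(tree_coef_cyc false ej' ej) -(tree_coef_cyc false ek ek').
rewrite -/(tree_side e e') -/(tree_side e' e).
have [[s2 s2'] ab E1 E2 E3] := cyc_cut_pattern eT eT' nee' ei ei'.
suff -> : f_ind D i e * f_ind D i e' * h_ind D i e e'
    + 2 * f_ind D i e * tree_side e' e - 2 * f_ind D i e' * tree_side e e'
  = f_ind D i e * (2 * tree_side e' e - tree_sign e') by ring.
(* The added last summand vanishes because [f_ind D i e] squares to 1. *)
transitivity (f_ind D i e * (f_ind D i e' * h_ind D i e e' + 2 * tree_side e' e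
   - 2 * (f_ind D i e * f_ind D i e') * tree_side e e')
  + 2 * f_ind D i e' * tree_side e e' * (f_ind D i e ^+ 2 - 1)); first by ring.
rewrite (f_ind_sqr ei) subrr mulr0 addr0.
congr (_ * _); rewrite E1 E3.
by case: ab => -[-> ->]; ring.
Qed.

(** Since [tree_side e' e] is 0 or [tree_sign e'], the last factor of [coef_linked_tree] is a sign
    too. *)
Lemma coef_linked_pm2 i j k e e' : linked D i j k e e' ->
  coef [tuple i; j; k] e e' = 2 \/ coef [tuple i; j; k] e e' = - 2.
Proof.
move=> lk; have [_ _ _ nee'] := linked_neq lk; have [eT eT'] := linked_in lk.
rewrite (coef_linked_tree lk); case/and5P: lk => ei ei' ej ej' /andP[ek ek'].
have [[_ s2'] ab _ _ _] := cyc_cut_pattern eT eT' nee' ei ei'.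
have : (2 * tree_side e' e - tree_sign e') ^+ 2 = 1.
  by apply: etrans s2'; case: ab => -[_ ->]; ring.
have := f_ind_sqr ei; have := f_ind_sqr ej; have := f_ind_sqr ek'.
do 3!move: (f_ind _ _ _) => ?; move: (_ - _) => ?.
have pm (x : int) : x ^+ 2 = 1 -> x = 1 \/ x = -1.
  by move/eqP; rewrite sqrf_eq1 => /orP[]/eqP; auto.
by do 4!case/pm=> ->; auto.
Qed.

(** Cycles containing the same ones among [e], [e'] give proportional columns, and a cycle avoiding
    both gives a zero column. A nonzero determinant thus needs one cycle of each remaining type. *)
Lemma coef_neq0_linked t e e' : coef t e e' != 0 ->
  exists i j k, perm_eq t [:: i; j; k] /\ linked D i j k e e'.
Proof.
case: t => -[|i [|j [|k []]]] //= sz nz.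
have {}nz : coef [tuple i; j; k] e e' != 0.
  by apply: contraNN nz => /eqP <-; apply/eqP; congr coef; apply: val_inj.
rewrite coefE in nz.
have nee' : e != e'.
  by apply: contraNneq nz => <-; apply/eqP; rewrite !weight_diag; ring.
have nij : i != j by apply: contraNneq nz => ->; apply/eqP; ring.
have nik : i != k by apply: contraNneq nz => ->; apply/eqP; ring.
have njk : j != k by apply: contraNneq nz => ->; apply/eqP; ring.
have tij : ((e \in cyc_edges D i) == (e \in cyc_edges D j)) &&
           ((e' \in cyc_edges D i) == (e' \in cyc_edges D j)) = false.
  apply: contraNF nz => /andP[/eqP t1 /eqP t2].
  have [M1 M2 M3] := same_type_minors nij nee' t1 t2; apply/eqP.
  (* Expansion along the column of the third index; the 2 by 2 minors vanish. *)
  transitivity (f_ind D k e' * (weight i e e' * f_ind D j e - weight j e e' * f_ind D i e)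
   - f_ind D k e * (weight i e e' * f_ind D j e' - weight j e e' * f_ind D i e')
   + weight k e e' * (f_ind D i e * f_ind D j e' - f_ind D j e * f_ind D i e'));
    first by ring.
  by rewrite M1 M2 M3; ring.
have tik : ((e \in cyc_edges D i) == (e \in cyc_edges D k)) &&
           ((e' \in cyc_edges D i) == (e' \in cyc_edges D k)) = false.
  apply: contraNF nz => /andP[/eqP t1 /eqP t2].
  have [M1 M2 M3] := same_type_minors nik nee' t1 t2; apply/eqP.
  transitivity (f_ind D j e * (weight i e e' * f_ind D k e' - weight k e e' * f_ind D i e')
   - f_ind D j e' * (weight i e e' * f_ind D k e - weight k e e' * f_ind D i e)
   - weight j e e' * (f_ind D i e * f_ind D k e' - f_ind D k e * f_ind D i e'));
    first by ring.
  by rewrite M1 M2 M3; ring.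
have tjk : ((e \in cyc_edges D j) == (e \in cyc_edges D k)) &&
           ((e' \in cyc_edges D j) == (e' \in cyc_edges D k)) = false.
  apply: contraNF nz => /andP[/eqP t1 /eqP t2].
  have [M1 M2 M3] := same_type_minors njk nee' t1 t2; apply/eqP.
  transitivity (f_ind D i e' * (weight j e e' * f_ind D k e - weight k e e' * f_ind D j e)
   - f_ind D i e * (weight j e e' * f_ind D k e' - weight k e e' * f_ind D j e')
   + weight i e e' * (f_ind D j e * f_ind D k e' - f_ind D k e * f_ind D j e'));
    first by ring.
  by rewrite M1 M2 M3; ring.
have ne0 l : (f_ind D l e = 0 -> f_ind D l e' = 0 -> weight l e e' = 0 -> False) ->
    (e \in cyc_edges D l) || (e' \in cyc_edges D l).
  move=> h; apply: contraT; rewrite negb_or => /andP[/f_ind_notin h1 /f_ind_notin h2].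
  by case: (h h1 h2); rewrite /weight h1 h2 !mulr0 !mul0r subr0 addr0.
have ni : (e \in cyc_edges D i) || (e' \in cyc_edges D i).
  by apply: ne0 => h1 h2 h3; case/eqP: nz; rewrite h1 h2 h3; ring.
have nj : (e \in cyc_edges D j) || (e' \in cyc_edges D j).
  by apply: ne0 => h1 h2 h3; case/eqP: nz; rewrite h1 h2 h3; ring.
have nk : (e \in cyc_edges D k) || (e' \in cyc_edges D k).
  by apply: ne0 => h1 h2 h3; case/eqP: nz; rewrite h1 h2 h3; ring.
have perms (x y z : 'I_(genus G)) : linked D x y z e e' ->
    (forall q, count q [:: i; j; k] = count q [:: x; y; z]) ->
    exists i' j' k', perm_eq [:: i; j; k] [:: i'; j'; k'] /\ linked D i' j' k' e e'.
  by move=> lk /seq.permP; exists x, y, z.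
move: {ne0 nz} tij tik tjk ni nj nk.
(* Six distributions of the types survive, one for each ordering of [i], [j], [k]. *)
case ei : (e \in cyc_edges D i); case ei' : (e' \in cyc_edges D i);
case ej : (e \in cyc_edges D j); case ej' : (e' \in cyc_edges D j);
case ek : (e \in cyc_edges D k); case ek' : (e' \in cyc_edges D k) => //= _ _ _ _ _ _;
first [by apply: (perms i j k) => [|q /=]; [rewrite /linked ei ei' ej ej' ek ek'|ring]
  |by apply: (perms i k j) => [|q /=]; [rewrite /linked ei ei' ej ej' ek ek'|ring]
  |by apply: (perms j i k) => [|q /=]; [rewrite /linked ei ei' ej ej' ek ek'|ring]
  |by apply: (perms j k i) => [|q /=]; [rewrite /linked ei ei' ej ej' ek ek'|ring]
  |by apply: (perms k i j) => [|q /=]; [rewrite /linked ei ei' ej ej' ek ek'|ring]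
  |by apply: (perms k j i) => [|q /=]; [rewrite /linked ei ei' ej ej' ek ek'|ring]].
Qed.

Lemma permute3P (I : eqType) (t : 3.-tuple I) (i j k : I) :
  perm_eq t [:: i; j; k] -> exists s, t = permute3 s [tuple i; j; k].
Proof. by move/(tuple_permP (t := [tuple i; j; k])) => [s /val_inj ->]; exists s. Qed.

Lemma coef_neq0P t e e' : coef t e e' != 0 <->
  exists i j k, perm_eq t [:: i; j; k] /\ linked D i j k e e'.
Proof.
split; first exact: coef_neq0_linked.
move=> [i [j [k [/permute3P[s ->] lk]]]]; rewrite coef_permute mulf_neq0 ?signr_eq0 //.
by case: (coef_linked_pm2 lk) => ->.
Qed.

Lemma coef_range t e e' : coef t e e' \in [:: 0; 2; -2].
Proof.
have [->//|nz] := eqVneq (coef t e e') 0.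
have [i [j [k [/permute3P[s ->] lk]]]] := coef_neq0_linked nz.
rewrite coef_permute; case: (coef_linked_pm2 lk) => ->;
by case: odd_perm; rewrite ?expr1 ?expr0 !inE.
Qed.

End Fundamental.

(** * Reversing one fundamental cycle *)

Section Flip.
Variables (o : orientation G) (lab : 'I_(genus G) -> edge G) (l : 'I_(genus G)).
Hypothesis labT : complement_labelling T lab.
Variable D : fundamental_system o v T lab.
Variable D' : fundamental_system (flip_edge o (lab l)) v T lab.

Lemma walk_chain_flip e0 w e :
  walk_chain (flip_edge o e0) w e = (-1) ^+ (e == e0) * walk_chain o w e.
Proof.
elim: w => [|d w IH]; first by rewrite /walk_chain !big_nil ffunE mulr0.
rewrite !walk_chain_cons !ffunE {}IH mulrDr !dart_chainE; congr (_ + _).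
case: ifP => _; last by rewrite mulr0.
rewrite ffunE; case: (e == e0); case: d.2; case: (o e) => /=;
by rewrite ?expr1 ?expr0 ?mulr1 ?mul1r ?mulrNN.
Qed.

(** One sign comes from reading coefficients at the flipped edge, the other from [cyc_pos], which
    makes cycle [l] run the other way. The new cycle is expanded in the old ones through its
    coefficients at the edges [lab j]. *)
Lemma f_ind_flip i e :
  f_ind D' i e = (-1) ^+ (e == lab l) * ((-1) ^+ (i == l) * f_ind D i e).
Proof.
rewrite {1}/f_ind /= walk_chain_flip; congr (_ * _).
have sgnK (b : bool) (x y : int) : x = (-1) ^+ b * y -> y = (-1) ^+ b * x.
  by move=> ->; rewrite mulrA -expr2 sqrr_sign mul1r.
have cyc_lab j : walk_chain o (cyc D' i) (lab j) = (-1) ^+ (j == l) * (i == j)%:R.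
  have := f_ind_lab labT D' i j; rewrite {1}/f_ind /= walk_chain_flip => /esym/sgnK.
  by rewrite (inj_eq labT.1).
have cc : is_cycle o (walk_chain o (cyc D' i)).
  by apply: closed_walk_cycle (cyc_walk D' i).
rewrite (cycle_lab_combination labT D cc) (bigD1 i) //= big1 => [|j ne].
  by rewrite addr0 cyc_lab eqxx mulr1 ffunMzE -mulrzl intz.
by rewrite cyc_lab (eq_sym i) (negPf ne) mulr0 mulr0z.
Qed.

Lemma cyc_edges_flip i e : (e \in cyc_edges D' i) = (e \in cyc_edges D i).
Proof. by rewrite !f_ind_mem f_ind_flip !mulf_eq0 !signr_eq0. Qed.

Lemma linked_flip i j k e e' : linked D' i j k e e' = linked D i j k e e'.
Proof. by rewrite /linked !cyc_edges_flip. Qed.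

Lemma tree_coef_flip e x : e \in T ->
  tree_coef (flip_edge o (lab l)) e x = tree_coef o e x.
Proof.
move=> eT; rewrite /tree_coef walk_chain_flip; case: eqVneq => [E|]; last by rewrite mul1r.
by rewrite E (negPf (lab_notin labT l)) in eT.
Qed.

(** In [coef_linked_tree] each cycle enters through one [f_ind], and the tree factor is unchanged
    because [e] and [e'] lie in [T]; exactly one sign flips. *)
Lemma coef_linked_flip i j k e e' : linked D i j k e e' -> l \in [:: i; j; k] ->
  coef D' [tuple i; j; k] e e' = - coef D [tuple i; j; k] e e'.
Proof.
move=> lk; have lk' : linked D' i j k e e' by rewrite linked_flip.
have [nij nik njk _] := linked_neq lk; have [eT eT'] := linked_in labT lk.
rewrite (coef_linked_tree labT lk) (coef_linked_tree labT lk').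
rewrite /tree_side /tree_sign !tree_coef_flip // !f_ind_flip.
have neT e0 : e0 \in T -> (e0 == lab l) = false.
  by move=> e0T; apply: contraTF e0T => /eqP ->; apply: lab_notin labT l.
rewrite !neT // !inE => /or3P[] /eqP ->; rewrite eqxx.
- by rewrite !(eq_sym _ i) (negPf nij) (negPf nik); ring.
- by rewrite (negPf nij) (eq_sym k) (negPf njk); ring.
- by rewrite (negPf nik) (negPf njk); ring.
Qed.

Lemma coef_flip t e e' : l \in t -> coef D' t e e' = - coef D t e e'.
Proof.
move=> lt; have hl i j k : perm_eq t [:: i; j; k] -> linked D i j k e e' ->
    coef D' t e e' = - coef D t e e'.
  move=> p lk; rewrite (perm_mem p) in lt; case/permute3P: p => s ->.
  by rewrite !coef_permute coef_linked_flip // mulrN.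
(* If either value is nonzero the triple is linked, and reversal preserves linkedness. *)
have [c0|nz] := eqVneq (coef D t e e') 0; last first.
  by have [i [j [k [p lk]]]] := coef_neq0_linked labT nz; apply: hl lk.
have [c0'|nz] := eqVneq (coef D' t e e') 0; first by rewrite c0 c0' oppr0.
have [i [j [k [p]]]] := coef_neq0_linked labT nz.
by rewrite linked_flip; apply: hl.
Qed.

End Flip.
End TreePotential.

(** * Sums of triple wedge products *)

Section Wedge.
Variables (R : comNzRingType) (M : lmodType R).
Implicit Types (u v w : M) (a : R).

Lemma linear_mapD (N : lmodType R) (f : M -> N) : linear f -> {morph f : u v / u + v}.
Proof. by move=> lf u v; rewrite -[u in LHS]scale1r lf scale1r. Qed.

Lemma linear_map0 (N : lmodType R) (f : M -> N) : linear f -> f 0 = 0.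
Proof. by move=> lf; apply: (addrI (f 0)); rewrite -linear_mapD // !addr0. Qed.

Lemma linear_mapZ (N : lmodType R) (f : M -> N) a : linear f -> {morph f : u / a *: u}.
Proof. by move=> lf u; rewrite -[a *: u in LHS]addr0 lf linear_map0 // addr0. Qed.

Lemma linear_mapN (N : lmodType R) (f : M -> N) : linear f -> {morph f : u / - u}.
Proof. by move=> lf u; rewrite -scaleN1r linear_mapZ // scaleN1r. Qed.

Lemma linear_map_sum (N : lmodType R) (f : M -> N) (I : Type) (r : seq I)
    (P : pred I) (F : I -> M) : linear f ->
  f (\sum_(i <- r | P i) F i) = \sum_(i <- r | P i) f (F i).
Proof. by move=> lf; exact: (big_morph f (linear_mapD lf) (linear_map0 lf)). Qed.

Lemma wedge3_linear1 v w : linear (fun u => wedge3 u v w).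
Proof. by move=> a u u'; rewrite wedge3_lin1. Qed.

Lemma wedge3_linear2 u w : linear (fun v => wedge3 u v w).
Proof. by move=> a v v'; rewrite wedge3_lin2. Qed.

Lemma wedge3_linear3 u v : linear (fun w => wedge3 u v w).
Proof. by move=> a w w'; rewrite wedge3_lin3. Qed.

Lemma wedge3_swap12 u v w : wedge3 v u w = - wedge3 u v w.
Proof.
apply/eqP; rewrite -addr_eq0 addrC; apply/eqP.
have := wedge3_alt12 (u + v) w.
rewrite (linear_mapD (wedge3_linear1 _ _)) !(linear_mapD (wedge3_linear2 _ _)).
by rewrite !wedge3_alt12 add0r addr0.
Qed.

Lemma wedge3_swap23 u v w : wedge3 u w v = - wedge3 u v w.
Proof.
apply/eqP; rewrite -addr_eq0 addrC; apply/eqP.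
have := wedge3_alt23 u (v + w).
rewrite (linear_mapD (wedge3_linear2 _ _)) !(linear_mapD (wedge3_linear3 _ _)).
by rewrite !wedge3_alt23 add0r addr0.
Qed.

Lemma wedge3_swap13 u v w : wedge3 w v u = - wedge3 u v w.
Proof. by rewrite wedge3_swap12 wedge3_swap23 wedge3_swap12 opprK. Qed.

(** Hence a simplex and its image under negation contribute equally to [Theta]. *)
Lemma wedge3_opp23 u v w : wedge3 u (- v) (- w) = wedge3 u v w.
Proof.
rewrite (linear_mapN (wedge3_linear2 _ _)) (linear_mapN (wedge3_linear3 _ _)).
exact: opprK.
Qed.

(** * Alternating families and sums over representatives *)

Section Family.
Variables (I : finType) (E : I -> M).

Definition wedge_tuple (t : 3.-tuple I) : ext3 M :=
  wedge3 (E (tnth t 0)) (E (tnth t 1)) (E (tnth t 2)).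

Lemma permute3M (s s' : 'S_3) (t : 3.-tuple I) :
  permute3 (s * s')%g t = permute3 s (permute3 s' t).
Proof. by apply: eq_from_tnth => x; rewrite !tnth_mktuple permM. Qed.

Lemma wedge_tuple_permute s t : wedge_tuple (permute3 s t) = (-1) ^+ s *: wedge_tuple t.
Proof.
have [ts -> dts] := prod_tpermP s.
elim: ts dts t => [|[x y] ts IH] /=.
  move=> _ t; rewrite big_nil odd_perm1 scale1r; congr wedge_tuple.
  by apply: eq_from_tnth => x; rewrite tnth_mktuple perm1.
case/andP=> nxy dts t; rewrite big_cons permute3M odd_mul_tperm [x != y]nxy signr_addb.
rewrite -scalerA -{}IH //= expr1 scaleN1r; move: {ts dts}(permute3 _ t) => {}t.
rewrite /wedge_tuple !tnth_mktuple.
have c3 (z : 'I_3) : [\/ z = 0, z = 1 | z = 2].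
  by case: z => -[|[|[|]]] // p; [apply: Or31|apply: Or32|apply: Or33]; apply: val_inj.
rewrite !permE /=.
by case: (c3 x) nxy => ->; case: (c3 y) => -> //= _;
  first [exact: wedge3_swap12|exact: wedge3_swap13|exact: wedge3_swap23].
Qed.

Lemma wedge_tuple_nuniq (t : 3.-tuple I) : ~~ uniq t -> wedge_tuple t = 0.
Proof.
case: t => -[|i [|j [|k []]]] //= sz.
rewrite /wedge_tuple !(tnth_nth i) /= !inE !negb_and !negbK ?andbT ?orbF.
by case/orP=> [/orP[]|] /eqP ->;
  [exact: wedge3_alt12|exact: wedge3_alt13|exact: wedge3_alt23].
Qed.

(** Triples with a repeated index have wedge zero; every other one is [permute3 s t] for exactly one
    [t] in [S] and one [s]. The coefficients collect into their antisymmetrization. *)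
Lemma sum_triple_reps (S : {set 3.-tuple I}) (c : 3.-tuple I -> R) : triple_reps S ->
  \sum_t c t *: wedge_tuple t =
  \sum_(t in S) (\sum_(s : 'S_3) (-1) ^+ s * c (permute3 s t)) *: wedge_tuple t.
Proof.
case=> Su S1.
have -> : \sum_(t in S) (\sum_(s : 'S_3) (-1) ^+ s * c (permute3 s t)) *: wedge_tuple t
        = \sum_(t in S) \sum_(s : 'S_3) c (permute3 s t) *: wedge_tuple (permute3 s t).
  apply: eq_bigr => t _; rewrite scaler_suml; apply: eq_bigr => s _.
  by rewrite wedge_tuple_permute scalerA mulrC.
rewrite exchange_big /=.
have permK (s : 'S_3) : cancel (@permute3 I s) (permute3 s^-1%g).
  move=> t; rewrite -permute3M mulVg.
  by apply: eq_from_tnth => x; rewrite tnth_mktuple perm1.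
have permKV (s : 'S_3) : cancel (permute3 s^-1%g) (@permute3 I s).
  by move=> t; rewrite -{1}[s]invgK permK.
transitivity (\sum_(s : 'S_3) \sum_(t | permute3 s^-1%g t \in S) c t *: wedge_tuple t).
  rewrite (exchange_big_dep xpredT) //=; apply: eq_bigr => t _.
  have [ut|/wedge_tuple_nuniq ->] := boolP (uniq t); last first.
    by rewrite scaler0 big1 // => s _; rewrite scaler0.
  (* As [t] has distinct entries, [s] is recoverable from the permuted triple, so [m] counts the
     representatives of [t]. *)
  rewrite sumr_const; set m := #|_|; suff -> : m = 1%N by [].
  transitivity #|[set t' in S | perm_eq t' t]|; last exact: S1; rewrite {}/m.
  pose f (s : 'S_3) := permute3 s^-1%g t.
  rewrite -(card_in_imset (f := f)); last first.
    move=> s s' _ _ ff; apply: invg_inj; apply/permP => x.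
    move/(congr1 (fun u : 3.-tuple I => tnth u x)): ff; rewrite !tnth_mktuple.
    exact: (elimT (tuple_uniqP t) ut).
  apply: eq_card => t'; rewrite inE; apply/imsetP/andP.
    move=> [s sS ->]; split; first exact: sS.
    by apply/tuple_permP; exists s^-1%g.
  move=> [tS /tuple_permP[s ts]]; exists s^-1%g; last by rewrite /f invgK; apply: val_inj.
  rewrite unfold_in invgK; have -> : permute3 s t = t' by apply/esym/val_inj.
  by [].
apply: eq_bigr => s _; rewrite (reindex (@permute3 I s)) /=; last first.
  by exists (permute3 s^-1%g) => t _; [exact: permK|exact: permKV].
by apply: eq_bigl => t; rewrite permK.
Qed.

End Family.
End Wedge.

(** The off-diagonal pairs outside [S] are exactly the mirror images of those in [S]. *)
Lemma sum_edge_pair_reps (V : zmodType) (E : finType) (S : {set E * E}) (F : E -> E -> V) :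
  edge_pair_reps S -> (forall e, F e e = 0) ->
  \sum_e \sum_e' F e e' = \sum_(p in S) (F p.1 p.2 + F p.2 p.1).
Proof.
case=> Sd Sx Fd; rewrite pair_big /= big_split /= (bigID (mem S)) /=; congr (_ + _).
rewrite (bigID (fun p => p.1 == p.2)) /= big1 ?add0r => [|p /andP[_ /eqP ->] //].
rewrite (reindex (fun p : E * E => (p.2, p.1))) /=; last first.
  by exists (fun p : E * E => (p.2, p.1)) => -[].
apply: eq_bigl => -[e e'] /=; case: eqVneq => [->|ne].
  by rewrite andbF (negPf (Sd _)).
rewrite andbT; move: (Sx e e'); rewrite eq_sym ne => /(_ isT).
by case: (_ \in S); case: (_ \in S).
Qed.

(** Consecutive partial sums differ by one term and [B] kills equal arguments, so each summand pairs
    the sum of the earlier terms with the new one. *)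
Lemma sum_take_alternating (R : comNzRingType) (M N : lmodType R) (B : M -> M -> N)
    (E : finType) (s : seq E) (y : E -> M) :
  (forall v, linear (B^~ v)) -> (forall u, linear (B u)) -> (forall u, B u u = 0) ->
  uniq s ->
  \sum_(1 <= j < size s) B (\sum_(e <- take j s) y e) (\sum_(e <- take j.+1 s) y e)
  = \sum_e \sum_e'
      if [&& e \in s, e' \in s & (index e s < index e' s)%N] then B (y e) (y e') else 0.
Proof.
move=> Bl Br Ba us.
have [->|s0] := eqVneq s [::].
  by rewrite big_geq // big1 // => e _; rewrite big1.
have [x0 sz] : exists x0 : E, (0 < size s)%N by case: s s0 {us} => // x; exists x.
pose V j := \sum_(e <- take j s) y e.
rewrite exchange_big /=.
(* The term at 0 may be added, the empty partial sum being zero; writing [j] as an index turns a sum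
   over positions into one over entries. *)
transitivity (\sum_(0 <= j < size s) B (V (index (nth x0 s j) s)) (y (nth x0 s j))).
  rewrite (big_ltn sz) index_uniq // /V take0 big_nil.
  rewrite (linear_map0 (Bl _)) add0r; apply: eq_big_nat => j /andP[_ js].
  rewrite index_uniq // (take_nth x0) // -cats1 big_cat big_seq1 /=.
  by rewrite (linear_mapD (Br _)) Ba add0r.
rewrite -(big_nth x0 xpredT (fun e' => B (V (index e' s)) (y e'))).
rewrite big_uniq //= big_mkcond; apply: eq_bigr => e' _.
case: ifP => [e's|_]; last by rewrite big1 // => e _; rewrite andbF.
rewrite /V big_uniq ?take_uniq //= (linear_map_sum _ _ _ (Bl _)) big_mkcond.
apply: eq_bigr => e _; congr (if _ then _ else _).
by have [es|/(contra (@mem_take _ _ _ _))/negPf->] := boolP (e \in s); rewrite ?in_take.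
Qed.

(** * The image of Upsilon under Theta *)

HB.instance Definition _ (U : zmodType) (A : comNzRingType) (f : Defs.hom U A) :=
  GRing.isZmodMorphism.Build U A^o f (hom_zmod_morphism f).

Lemma hom_sumE (U : zmodType) (A : comNzRingType) (I : finType) (F : I -> Defs.hom U A) h :
  (\sum_i F i) h = \sum_i F i h.
Proof. exact: (big_morph (fun f : Defs.hom U A => f h) (fun _ _ => erefl) erefl). Qed.

Section PiChain.
Variables (G : multigraph) (o : orientation G).
Implicit Types (c : chain1 G) (e : edge G).

Lemma pi_chainE c : pi_chain o c = \sum_e (c e)%:~R *: pi_chain o (edge_chain e).
Proof.
apply/val_inj/funext => h /=; rewrite hom_sumE; apply: eq_bigr => e _.
by rewrite -[RHS]/(_ * pairing _ _) pairing_edge rmorphM mulrA.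
Qed.

Lemma pi_chainD : {morph pi_chain o : c c' / c + c'}.
Proof.
move=> c c'; apply/val_inj/funext => h.
rewrite -[LHS]/(pairing _ _) -[RHS]/(pairing _ _ + pairing _ _).
by rewrite -big_split; apply: eq_bigr => e _; rewrite ffunE mulrDl rmorphD mulrDl.
Qed.

Lemma pi_chain0 : pi_chain o 0 = 0.
Proof. by apply: (addrI (pi_chain o 0)); rewrite -pi_chainD !addr0. Qed.

Lemma pi_chain_edge_mulz e (n : int) :
  pi_chain o (edge_chain e *~ n) = n%:~R *: pi_chain o (edge_chain e).
Proof.
apply/val_inj/funext => h; rewrite -[LHS]/(pairing _ _) -[RHS]/(_ * pairing _ _).
rewrite /pairing mulr_sumr; apply: eq_bigr => e' _.
have -> : (edge_chain e *~ n) e' = n * edge_chain e e' by rewrite ffunMzE -mulrzl intz.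
by rewrite -mulrA rmorphM mulrA.
Qed.

End PiChain.

(** * Expansion of the summands of [Upsilon] *)

Section ThetaFormula.
Variables (G : multigraph) (v : vert G) (T : {set edge G}) (o : orientation G).
Variable lab : 'I_(genus G) -> edge G.
Hypotheses (treeT : spanning_tree T) (labT : complement_labelling T lab).
Variable D : fundamental_system o v T lab.
Variable eps : 'I_(genus G) -> cohomology o.
Hypothesis eps_dual : dual_basis D eps.
Implicit Types (i j k : 'I_(genus G)) (e : edge G).

Let E i := extend_scalars (eps i).
Let X e := pi_chain o (edge_chain e).

(** [eps j] reads off the coefficient of a cycle at [lab j], so expanding a cycle in the fundamental
    ones gives its coefficient at [e]. *)
Lemma pi_edge_dual e :
  pi_chain o (edge_chain e) = \sum_j ((f_ind D j e)%:~R * xvar e) *: extend_scalars (eps j).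
Proof.
apply/val_inj/funext => h; rewrite -[LHS]/(pairing _ _) pairing_edge /= hom_sumE.
have hcomb := cycle_lab_combination treeT labT D (valP h).
have eps_h j : eps j h = cycle_chain h (lab j).
  have hE : h = \sum_i gamma D i *~ cycle_chain h (lab i).
    apply: val_inj; rewrite [LHS]hcomb raddf_sum; apply: eq_bigr => i _.
    by rewrite raddfMz.
  rewrite [in LHS]hE raddf_sum (bigD1 j) //= big1 => [|i ne].
    by rewrite raddfMz /= eps_dual eqxx addr0 -mulrzl mulr1 intz.
  by rewrite raddfMz /= eps_dual eq_sym (negPf ne) mul0rz.
transitivity (\sum_j (cycle_chain h (lab j) * f_ind D j e)%:~R * xvar e).
  rewrite -mulr_suml -rmorph_sum /=; congr (_%:~R * _).
  rewrite [in LHS]hcomb sum_ffunE; apply: eq_bigr => j _.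
  by rewrite ffunMzE -mulrzl intz.
apply: eq_bigr => j _.
rewrite -[RHS]/(_ * (eps j h)%:~R) eps_h rmorphM /=; ring.
Qed.

Let th i := @theta_chain _ _ (@period_lattice G o) _ (@extend_scalars G o) (eps i).

Lemma theta_chain_tri i u0 u1 u2 :
  th i (tri u0 u1 u2) = wedge3 (E i) (u1 - u0) (u2 - u0).
Proof. by rewrite /th theta_chain_simplex. Qed.

Lemma theta_chainB i : zmod_morphism (th i).
Proof. by apply: qliftB => x; apply: theta_translate. Qed.

HB.instance Definition _ i :=
  GRing.isZmodMorphism.Build (jac_chains o 2) (ext3 (cohomologyR o)) (th i) (theta_chainB i).

Lemma Theta_Upsilon_sum : Theta (Upsilon D eps) = \sum_i th i (Upsilon_ D i).
Proof.
have tD := @thetaD _ _ (@period_lattice G o) _ (@extend_scalars G o).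
have t0 : theta (@extend_scalars G o) (0 : jac_chains12 o) = 0.
  by have := tD 0 0; rewrite addr0 => /eqP; rewrite -subr_eq0 opprD addNKr oppr_eq0 => /eqP.
rewrite /Upsilon /Theta (big_morph _ tD t0).
by apply: eq_bigr => i _; rewrite theta_tens.
Qed.

Definition path_sum i n := \sum_(e <- take n (cyc_edges D i)) (f_ind D i e)%:~R *: X e.

Lemma upointE i n : upoint D i n = pi_chain o (delta D i) + path_sum i n.
Proof.
rewrite /upoint pi_chainD; congr (_ + _).
rewrite (big_morph _ (@pi_chainD _ o) (pi_chain0 o)).
by apply: eq_bigr => e _; rewrite pi_chain_edge_mulz.
Qed.

(** Mirror simplices double the first sum; the two simplices joining [u 0] to [- u 0] each
    contribute twice the wedge with the stem. *)
Lemma theta_Upsilon_i i : th i (Upsilon_ D i) =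
  (\sum_(1 <= j < cyc_size D i) wedge3 (E i) (path_sum i j) (path_sum i j.+1)) *+ 2
  + wedge3 (E i) (pi_chain o (delta D i)) (path_sum i (cyc_size D i)) *+ 4.
Proof.
have u0 : upoint D i 0 = pi_chain o (delta D i).
  by rewrite upointE /path_sum take0 big_nil addr0.
have thD : {morph th i : c c' / c + c'} by apply: raddfD.
rewrite /Upsilon_ theta_chainB 2!thD !raddf_sum /=.
(* Each subtracted simplex ends at its initial vertex, so its third wedge factor is zero. *)
rewrite [X in _ + X = _]big1 => [|j _]; last first.
  rewrite !thD !theta_chain_tri !subrr.
  rewrite !(linear_map0 (wedge3_linear2 _ _)) !(linear_map0 (wedge3_linear3 _ _)).
  by rewrite !addr0 oppr0.
rewrite addr0 -addrA; congr (_ + _).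
  rewrite -sumrMnl; apply: eq_bigr => j _.
  rewrite thD !theta_chain_tri u0 !upointE -!opprD wedge3_opp23.
  by rewrite ![pi_chain o (delta D i) + _ - _]addrAC !subrr !add0r mulr2n.
rewrite !theta_chain_tri u0 upointE addrAC subrr add0r.
move: (pi_chain o (delta D i)) (path_sum _ _) => p a.
rewrite -!opprD [p + a + p]addrAC wedge3_opp23 (linear_mapN (wedge3_linear3 _ _)).
rewrite -wedge3_swap23 (linear_mapD (wedge3_linear3 _ _) (p + p)) wedge3_alt23 add0r.
by rewrite (linear_mapD (wedge3_linear2 _ _)) -!mulr2n -mulrnA.
Qed.

Lemma theta_Upsilon_i_edges i : th i (Upsilon_ D i) =
  \sum_e \sum_e'
    (2 * f_ind D i e * f_ind D i e' *
       [&& e \in cyc_edges D i, e' \in cyc_edges D i &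
           (index e (cyc_edges D i) < index e' (cyc_edges D i))%N]%:R
     + 4 * g_ind D i e * f_ind D i e')%:~R *: wedge3 (E i) (X e) (X e').
Proof.
rewrite theta_Upsilon_i.
have -> : path_sum i (cyc_size D i) = \sum_e (f_ind D i e)%:~R *: X e.
  rewrite /path_sum take_size big_uniq ?cyc_uniq //= big_mkcond.
  apply: eq_bigr => e _; case: ifP => // /negbT/f_ind_notin ->.
  by rewrite scale0r.
have size_i : cyc_size D i = size (cyc_edges D i) by [].
rewrite size_i sum_take_alternating //; last first.
- exact: cyc_uniq.
- exact: wedge3_alt23.
- exact: wedge3_linear3.
- by move=> w; apply: wedge3_linear2.
rewrite pi_chainE (linear_map_sum _ _ _ (wedge3_linear2 _ _)) -!sumrMnl -big_split.
apply: eq_bigr => e _.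
rewrite (linear_map_sum _ _ _ (wedge3_linear3 _ _)) -!sumrMnl -big_split.
apply: eq_bigr => e' _ /=.
rewrite !(linear_mapZ _ (wedge3_linear2 _ _)) !(linear_mapZ _ (wedge3_linear3 _ _)).
rewrite rmorphD scalerDl -/(X e); congr (_ + _).
  case: ifP => _; last by rewrite mulr0 scale0r mul0rn.
  rewrite -scaler_nat !scalerA mulr1; congr (_ *: _).
  by rewrite !rmorphM /= mulrA.
rewrite -scaler_nat !scalerA; congr (_ *: _).
by rewrite !rmorphM /= mulrA.
Qed.

(** Merging [(e, e')] with [(e', e)] by antisymmetry turns the indicator of order into [h_ind] and
    yields both stem terms of [weight]. *)
Lemma theta_Upsilon_i_pairs i (S : {set edge G * edge G}) : edge_pair_reps S ->
  th i (Upsilon_ D i) =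
  \sum_(p in S) (weight D i p.1 p.2)%:~R *: wedge3 (E i) (X p.1) (X p.2).
Proof.
move=> repS; rewrite theta_Upsilon_i_edges (sum_edge_pair_reps repS) => [|e]; last first.
  by rewrite wedge3_alt23 scaler0.
apply: eq_bigr => -[e e'] pS /=; rewrite [wedge3 _ (X e') _]wedge3_swap23.
rewrite scalerN -scalerBl -rmorphB /=; congr (_%:~R *: _).
have nee' : (e == e') = false.
  by apply: contraTF pS => /eqP ->; apply: repS.1.
rewrite /weight /h_ind nee' orbF.
have [ei|nei] := boolP (e \in _); last by rewrite (f_ind_notin nei) /=; ring.
have [ei'|nei'] := boolP (e' \in _); last by rewrite (f_ind_notin nei') /=; ring.
rewrite /=; case: ltngtP => [_|_|E0]; rewrite ?mulr1 ?mulr0; try ring.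
by move/eqP: nee'; case; rewrite -(nth_index e ei) E0 nth_index.
Qed.

Lemma wedge3_edges i e e' : wedge3 (E i) (X e) (X e') =
  \sum_j \sum_k ((f_ind D j e * f_ind D k e')%:~R * xvar e * xvar e')
    *: wedge3 (E i) (E j) (E k).
Proof.
rewrite {1}/X pi_edge_dual (linear_map_sum _ _ _ (wedge3_linear2 _ _)).
apply: eq_bigr => j _; rewrite (linear_mapZ _ (wedge3_linear2 _ _)).
rewrite /X pi_edge_dual (linear_map_sum _ _ _ (wedge3_linear3 _ _)) scaler_sumr.
apply: eq_bigr => k _; rewrite (linear_mapZ _ (wedge3_linear3 _ _)) scalerA.
congr (_ *: _); rewrite rmorphM /=; ring.
Qed.

(** Leibniz expansion, in the antisymmetrized shape produced by [sum_triple_reps]. *)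
Lemma coef_sum t e e' : coef D t e e' = \sum_(s : 'S_3) (-1) ^+ s *
   (weight D (tnth (permute3 s t) 0) e e' * f_ind D (tnth (permute3 s t) 1) e
     * f_ind D (tnth (permute3 s t) 2) e').
Proof.
rewrite /coef /determinant; apply: eq_bigr => s _.
rewrite !big_ord_recl big_ord0 mulr1 !mxE !tnth_mktuple -mulrA.
have -> : fintype.lift ord0 ord0 = 1 :> 'I_3 by apply: val_inj.
have -> : fintype.lift ord0 (fintype.lift ord0 ord0) = 2 :> 'I_3 by apply: val_inj.
by [].
Qed.

Lemma sum_triples (V : zmodType) (I : finType) (F : I -> I -> I -> V) :
  \sum_i \sum_j \sum_k F i j k =
  \sum_(t : 3.-tuple I) F (tnth t 0) (tnth t 1) (tnth t 2).
Proof.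
rewrite pair_big /= pair_big /=.
rewrite (reindex (fun t : 3.-tuple I => (tnth t 0, tnth t 1, tnth t 2))) //=.
exists (fun p => [tuple p.1.1; p.1.2; p.2]) => [t _|[[i j] k] _] //=.
apply: eq_from_tnth => x; case: x => -[|[|[|]]] // p; rewrite (tnth_nth (tnth t 0)) /=;
by congr tnth; apply: val_inj.
Qed.

Lemma Theta_Upsilon (S : {set edge G * edge G}) (S' : {set 3.-tuple 'I_(genus G)}) :
  edge_pair_reps S -> triple_reps S' ->
  Theta (Upsilon D eps) =
    \sum_(p in S) \sum_(t in S')
      ((coef D t p.1 p.2)%:~R * xvar p.1 * xvar p.2) *: wedge_tuple E t.
Proof.
move=> repS repS'; rewrite Theta_Upsilon_sum.
under eq_bigr => i _ do rewrite (theta_Upsilon_i_pairs i repS).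
rewrite exchange_big; apply: eq_bigr => -[e e'] _ /=.
transitivity (\sum_i \sum_j \sum_k
  ((weight D i e e' * f_ind D j e * f_ind D k e')%:~R * xvar e * xvar e')
    *: wedge3 (E i) (E j) (E k)).
  apply: eq_bigr => i _; rewrite wedge3_edges scaler_sumr; apply: eq_bigr => j _.
  rewrite scaler_sumr; apply: eq_bigr => k _; rewrite scalerA; congr (_ *: _).
  by rewrite !rmorphM /=; ring.
pose c (t : 3.-tuple 'I_(genus G)) : edge_ring G :=
  (weight D (tnth t 0) e e' * f_ind D (tnth t 1) e * f_ind D (tnth t 2) e')%:~R
    * xvar e * xvar e'.
rewrite sum_triples.
transitivity (\sum_t c t *: wedge_tuple E t); first by apply: eq_bigr.
refine (etrans (sum_triple_reps E c repS') _).
apply: eq_bigr => t _; congr (_ *: _).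
rewrite coef_sum rmorph_sum !mulr_suml; apply: eq_bigr => s _.
rewrite /= (intrM _ (_ ^+ _)) intr_sign -!mulrA.
by congr (_ * _); rewrite /c -!mulrA.
Qed.

End ThetaFormula.

Theorem proposition3p6 (G : multigraph) (v : vert G) (T : {set edge G})
    (lab : 'I_(genus G) -> edge G)
    (S : {set edge G * edge G}) (S' : {set 3.-tuple 'I_(genus G)}) :
  connected_graph G -> spanning_tree T -> complement_labelling T lab ->
  edge_pair_reps S -> triple_reps S' ->
  exists a : forall o : orientation G, fundamental_system o v T lab ->
      3.-tuple 'I_(genus G) -> edge G -> edge G -> int,
    (forall (o : orientation G) (D : fundamental_system o v T lab),
      [/\ forall eps : 'I_(genus G) -> cohomology o, dual_basis D eps ->
            Theta (Upsilon D eps) =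
              \sum_(p in S) \sum_(t in S')
                ((a o D t p.1 p.2)%:~R * xvar p.1 * xvar p.2) *:
                wedge3 (extend_scalars (eps (tnth t 0)))
                       (extend_scalars (eps (tnth t 1)))
                       (extend_scalars (eps (tnth t 2))),
          forall (t : 3.-tuple 'I_(genus G)) (e e' : edge G), a o D t e e' \in [:: 0; 2; -2],
          forall (t : 3.-tuple 'I_(genus G)) (e e' : edge G), a o D t e e' != 0 <->
            exists i j k : 'I_(genus G), perm_eq t [:: i; j; k] /\ linked D i j k e e',
          forall (s : 'S_3) (t : 3.-tuple 'I_(genus G)) (e e' : edge G),
            a o D (permute3 s t) e e' = (-1) ^+ s * a o D t e e'
        & forall (i j k : 'I_(genus G)) (e e' : edge G), linked D i j k e e' ->
            a o D [tuple i; j; k] e e' =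
              2 * f_ind D j e * f_ind D k e' *
              (f_ind D i e * f_ind D i e' * h_ind D i e e'
               + 2 * f_ind D i e * g_ind D j e' - 2 * f_ind D i e' * g_ind D k e)])
    /\ (forall (o : orientation G) (l : 'I_(genus G))
          (D : fundamental_system o v T lab)
          (D' : fundamental_system (flip_edge o (lab l)) v T lab)
          (t : 3.-tuple 'I_(genus G)) (e e' : edge G),
          l \in t -> a (flip_edge o (lab l)) D' t e e' = - a o D t e e').
Proof.
move=> _ treeT labT repS repS'.
(* Choice fixes a tree walk to each vertex; these walks enter the proofs but not the witness
   [coef]. *)
have /choice[tw twP] : forall x, exists w, walk v w x /\ walk_in T w.
  by move=> x; have [w ww wT] := treeT.1 v x; exists w.
have tw1 x := (twP x).1; have tw2 x := (twP x).2.
exists (fun o D => coef D); split=> [o D|o l D D' t e e' lt]; last first.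
  exact: (coef_flip tw1 tw2 treeT labT).
split.
- by move=> eps eps_dual; apply: Theta_Upsilon.
- exact: (coef_range tw1 tw2 treeT labT).
- exact: (coef_neq0P tw1 tw2 treeT labT).
- exact: coef_permute.
- exact: (coef_linked tw1 tw2 treeT).
Qed.
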